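(* Let $k$ be an algebraically closed field, $R=k[x,y,z]$, and let $X=V(f)\subset\mathbb P^2_k$ be a reduced curve of degree $d+1\ge 2$, where $\operatorname{char}(k)$ does not divide $d+1$. Then $\operatorname{Bour}(X)=1$ if and only if $X$ is nearly free.
   Context: $J_f=(f_x,f_y,f_z)\subset R$ is the gradient ideal. $\operatorname{Syz}(J_f)=\{(a,b,c)\in R^3: af_x+bf_y+cf_z=0\}$ is graded as a submodule of $R^3$ (a syzygy has degree $n$ if its coordinates are forms of degree $n$). For a graded module $M=\bigoplus_{i\ge 0}M_i$, $\operatorname{indeg}(M)=\min\{i: M_i\ne 0\}$. The curve $X$ (or $f$) is a free divisor if $\operatorname{Syz}(J_f)$ is a free $R$-module. Bourbaki degree: let $e=\operatorname{indeg}(\operatorname{Syz}(J_f))$. If $f$ is a free divisor, set $\operatorname{Bour}(X)=0$. Otherwise choose a minimal generator $\epsilon\in\operatorname{Syz}(J_f)$ of degree $e$; the cokernel of $R(-e)\stackrel{\epsilon}{\to}\operatorname{Syz}(J_f)$ is isomorphic, by a degree-zero graded isomorphism, to $I_\epsilon(e-d)$ for a proper homogeneous ideal $I_\epsilon\subset R$ of codimension two, and $\operatorname{Bour}(X):=\deg(R/I_\epsilon)$ (algebraic multiplicity), which does not depend on the choice of $\epsilon$ of degree $e$. Nearly free: a reduced curve $X=V(f)$ of degree $d+1$ is called nearly free if $R/J_f$ has a graded minimal free resolution of the form $$0\to R(-d-a_2-1)\to R(-d-a_1)\oplus R(-d-a_2)^2\to R(-d)^3\to R\to R/J_f\to 0$$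 for some integers $1\leq a_1\leq a_2$. *)

(* Defs.v *)
From HB Require Import structures.
From mathcomp Require Import all_boot all_order all_algebra.
From mathcomp Require Import mpoly.
From Stdlib Require Import ClassicalEpsilon.

Set Implicit Arguments.
Unset Strict Implicit.
Unset Printing Implicit Defensive.

Import GRing.Theory.
Local Open Scope ring_scope.

(* R = k[x, y, z] is {mpoly k[3]}; elements of R^n are row vectors, so a      *)
(* matrix A : 'M[R]_(m, n) is the map R^m -> R^n, v |-> v *m A.               *)

Section Defs.
Variable k : fieldType.
Local Notation R := {mpoly k[3]}.

Section Ideals.

(* R/(f) is a reduced ring. *)
Definition reduced_form (f : R) : Prop :=
  forall (g : R) (n : nat), (exists q, g ^+ n = q * f) -> exists q, g = q * f.

Definition homogeneous_ideal (I : {pred R}) : Prop :=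
  forall (p : R) (n : nat), p \in I -> pihomog mdeg n p \in I.

(* idealr_closed includes properness, 1 \notin P. *)
Definition prime_ideal (P : {pred R}) : Prop :=
  idealr_closed P /\ prime_idealr_closed P.

Definition height_ge (P : {pred R}) (h : nat) : Prop :=
  exists c : nat -> {pred R},
    [/\ forall i, (i <= h)%N -> prime_ideal (c i),
        forall i, (i < h)%N ->
          {subset c i <= c i.+1} /\ (exists2 p, p \in c i.+1 & p \notin c i)
      & c h =i P].

(* The codimension (height) of I: the least height of a prime containing I. *)
Definition codim_ideal (I : {pred R}) (c : nat) : Prop :=
  (forall P, prime_ideal P -> {subset I <= P} -> height_ge P c) /\
  (exists P, [/\ prime_ideal P, {subset I <= P} & ~ height_ge P c.+1]).

(* h = dim_k (R/I)_n. *)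
Definition hilbert_function (I : {pred R}) (n h : nat) : Prop :=
  exists2 U : {vspace (dhomog 3 k n)},
    forall p : dhomog 3 k n, (p \in U) = ((p : R) \in I)
    & h = (\dim {: dhomog 3 k n} - \dim U)%N.

(* deg(R/I) = m: (D-1)! times the leading coefficient of the Hilbert          *)
(* polynomial P of R/I, where D = size P is the dimension of R/I.  No degree  *)
(* is assigned when P = 0, that is, when R/I has finite length.               *)
Definition quotient_degree (I : {pred R}) (m : nat) : Prop :=
  exists (H : nat -> nat) (P : {poly rat}),
    [/\ forall n, hilbert_function I n (H n),
        exists N, forall n, (N <= n)%N -> (H n)%:R = P.[n%:R],
        P != 0
      & m%:R = ((size P).-1)`!%:R * lead_coef P].

End Ideals.

Section Modules.
Variable r : nat.
Implicit Types (M : {pred 'rV[R]_r}) (v : 'rV[R]_r).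

Definition vhomog (n : nat) v : Prop := forall i, v 0 i \is n.-homog.

Definition is_indeg M (e : nat) : Prop :=
  (exists v, [/\ v \in M, vhomog e v & v != 0]) /\
  (forall n v, (n < e)%N -> v \in M -> vhomog n v -> v = 0).

(* Freeness for submodules of R^r; these are finitely generated, so that a    *)
(* basis (the rows of B) is finite.                                           *)
Definition free_submodule M : Prop :=
  exists (n : nat) (B : 'M[R]_(n, r)),
    (forall v, v \in M <-> exists c : 'rV[R]_n, v = c *m B) /\
    (forall c : 'rV[R]_n, c *m B = 0 -> c = 0).

(* v belongs to M but not to (x, y, z) M. *)
Definition minimal_generator M v : Prop :=
  v \in M /\
  ~ (exists w : 'I_3 -> 'rV[R]_r,
       (forall i, w i \in M) /\ v = \sum_(i < 3) 'X_i *: w i).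

(* M / R eps is isomorphic to I(e - d) by a graded isomorphism of degree 0,   *)
(* given as a linear map phi on M with kernel R eps and image I; the piece of *)
(* degree n of I(e - d) is I_(n + e - d), which is 0 when n + e < d.          *)
Definition cokernel_iso M (eps : 'rV[R]_r) (e d : nat) (I : {pred R}) : Prop :=
  exists phi : 'rV[R]_r -> R,
    [/\ forall (a : R) u v, u \in M -> v \in M ->
          phi (a *: u + v) = a * phi u + phi v,
        forall v, v \in M -> (phi v = 0 <-> exists a : R, v = a *: eps),
        forall p, p \in I <-> exists2 v, v \in M & phi v = p
      & forall n v, v \in M -> vhomog n v ->
          ((d <= n + e)%N -> phi v \is (n + e - d).-homog) /\
          ((n + e < d)%N -> phi v = 0)].

End Modules.

Definition Syz (f : R) : {pred 'rV[R]_3} :=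
  [pred v : 'rV[R]_3 | \sum_(i < 3) v 0 i * f^`M(i) == 0].

Definition gradient_ideal (f p : R) : Prop :=
  exists v : 'rV[R]_3, p = \sum_(i < 3) v 0 i * f^`M(i).

Definition free_divisor (f : R) : Prop := free_submodule (Syz f).

(* In this and the next definitions, f is a form of degree d + 1. *)
Definition bourbaki_ideal (d : nat) (f : R) (I : {pred R}) : Prop :=
  exists (e : nat) (eps : 'rV[R]_3),
    [/\ is_indeg (Syz f) e,
        minimal_generator (Syz f) eps,
        vhomog e eps
      & [/\ idealr_closed I, homogeneous_ideal I, codim_ideal I 2
          & cokernel_iso (Syz f) eps e d I]].

(* deg(R/I) for a chosen Bourbaki ideal I when f is not free; it depends      *)
(* neither on eps nor on I.  The last 0 is a default value: if f is a reduced *)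
(* form of degree d + 1 with d + 1 nonzero in k, a Bourbaki ideal exists as   *)
(* soon as f is not free.                                                     *)
Definition Bour (d : nat) (f : R) : nat :=
  if excluded_middle_informative (free_divisor f) then 0%N else
  match excluded_middle_informative
    (exists m, exists2 I, bourbaki_ideal d f I & quotient_degree I m) with
  | left ex => proj1_sig (constructive_indefinite_description _ ex)
  | right _ => 0%N
  end.

(* A defines a map of degree 0 from the sum of the R(- a_i) to the sum of the *)
(* R(- b_j).                                                                  *)
Definition graded_map m n (a : m.-tuple nat) (b : n.-tuple nat)
    (A : 'M[R]_(m, n)) : Prop :=
  forall i j,
    ((tnth b j <= tnth a i)%N -> A i j \is (tnth a i - tnth b j).-homog) /\
    ((tnth a i < tnth b j)%N -> A i j = 0).

(* The entries of A belong to the ideal (x, y, z). *)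
Definition minimal_map m n (A : 'M[R]_(m, n)) : Prop :=
  forall i j, (A i j)@_0%MM = 0.

Definition exact_at m n p (A : 'M[R]_(m, n)) (B : 'M[R]_(n, p)) : Prop :=
  forall v : 'rV[R]_n, v *m B = 0 <-> exists u : 'rV[R]_m, v = u *m A.

Definition nearly_free (d : nat) (f : R) : Prop :=
  exists a1 a2 : nat, (1 <= a1 <= a2)%N /\
  exists (A3 : 'M[R]_(1, 3)) (A2 : 'M[R]_(3, 3)) (A1 : 'M[R]_(3, 1)),
    [/\ [/\ graded_map [tuple (d + a2 + 1)%N]
              [tuple (d + a1)%N; (d + a2)%N; (d + a2)%N] A3,
            graded_map [tuple (d + a1)%N; (d + a2)%N; (d + a2)%N]
              [tuple d; d; d] A2
          & graded_map [tuple d; d; d] [tuple 0%N] A1],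
        [/\ minimal_map A3, minimal_map A2 & minimal_map A1]
      & [/\ forall c : 'rV[R]_1, c *m A3 = 0 -> c = 0,
            exact_at A3 A2,
            exact_at A2 A1
          & forall p : R, gradient_ideal f p <->
              exists v : 'rV[R]_3, p%:M = v *m A1]].

End Defs.

(* Main.v *)
(* Let S = Syz(J_f) and h(n) = dim R_n.                                       *)
(* A reduced f has gradient ideal J_f of codimension >= 2, in the elementary  *)
(* form that dim (R/J_f)_n is bounded: over k(two variables)[x_i] the ideal   *)
(* (f, f_x, f_y, f_z) is the unit ideal, since an irreducible common factor,  *)
(* not being repeated in f, would divide its own derivatives, hence be killed *)
(* by all derivations up to scaling, hence be a p-th power; so J_f contains,  *)
(* for each i, a nonzero form free of x_i, and reducing by their leading      *)
(* monomials leaves boundedly many monomials in each degree.                  *)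
(* If S / R eps is isomorphic to a shift I(e - d') of an ideal, then dim      *)
(* I_(n+e-d') + h(n-e) = dim S_n = 3 h(n) - dim (J_f)_(n+d), and comparing    *)
(* coefficients of n shows that R/I has bounded Hilbert function if d' = d,   *)
(* and that d' = d if R/I has Hilbert function 1.  The Hilbert function of    *)
(* R/I in large degrees depends only on e, so the degree is well defined.     *)
(* If deg R/I = 1 then R/I has Hilbert function 1 in large degrees; as I is   *)
(* saturated (S is a second syzygy module), it is the ideal (l1, l2) of a     *)
(* point.  Lifting l1, l2 to S gives three generators, whose only relation    *)
(* lifts the Koszul relation of l1 and l2: this is the nearly free            *)
(* resolution.                                                                *)
(* Conversely the last map of such a resolution is (g, l1, l2) with l1, l2    *)
(* independent linear forms, and S / R eps is then isomorphic to (l1, l2).    *)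

From HB Require Import structures.
Require Import Defs.
From mathcomp Require Import all_boot all_order all_algebra.
From mathcomp Require Import mpoly ring zify.
From Stdlib Require Import ClassicalEpsilon.

Set Implicit Arguments.
Unset Strict Implicit.
Unset Printing Implicit Defensive.

Import GRing.Theory Num.Theory.
Local Open Scope ring_scope.

(** * Polynomial substitutions and homogeneous components *)

(** Both directions rest on one dimension count. Since f is reduced and d + 1 is invertible, R/J_f
    has bounded Hilbert function ([elimination], [monomial_reduction], [gradient_quotient_bounded]).
    A Bourbaki sequence 0 -> R(-e) -> S -> I(e - d') -> 0 then determines dim I_m from S and e
    ([bourbaki_dim]), and comparing the terms linear in the degree shows that R/I is bounded when d'
    = d ([bourbaki_codim_bounded]) and that codimension 1 in all degrees forces d' = d
    ([bourbaki_shift]).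

    If Bour(X) = 1, boundedness turns the degree into the eventual value of the Hilbert function
    ([quotient_degree_bounded]). The ideal I is saturated because S is torsion-closed in R^3
    ([image_saturated]), so I is the ideal of a point ([degree1_ideal_point]). The two lines
    generating it lift to syzygies E2, E3, which generate S together with eps; their Koszul relation
    lifts to the only relation, and this is the nearly free resolution ([point_ideal_nearly_free]).

    Conversely, minimality of the resolution makes the two linear entries of its last map
    independent ([relation_not_proportional]) and excludes freeness ([not_free]). Sending a syzygy
    with coefficients u to u_1 l2 - u_2 l1 identifies S / R eps with a shift of the point ideal (l1,
    l2) ([relation_cokernel]), whose codimension is 2 ([point_ideal_codim]) and whose Hilbert
    function is 1. Since [Bour] is defined by a choice, [bourbaki_degree_unique] is what carries
    this value over to the chosen ideal. *)

Lemma fun_choice (A B : Type) (P : A -> B -> Prop) :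
  (forall x, exists y, P x y) -> exists g, forall x, P x (g x).
Proof.
move=> H; exists (fun x => proj1_sig (constructive_indefinite_description _ (H x))) => x.
by case: constructive_indefinite_description.
Qed.

Lemma rV_neq0 (A : nmodType) n (v : 'rV[A]_n) : v != 0 -> exists i, v 0 i != 0.
Proof.
move=> v0; apply/existsP; apply: contraNT v0; rewrite negb_exists => /forallP z.
by apply/eqP/rowP => i; have /negPn/eqP -> := z i; rewrite mxE.
Qed.

Section MPolyInd.
Variables (n : nat) (K : nzRingType).
Local Notation R := {mpoly K[n]}.

Lemma mpoly_alg_ind (P : R -> Prop) :
  (forall c, P c%:MP) -> (forall i, P 'X_i) ->
  (forall p q, P p -> P q -> P (p + q)) ->
  (forall p q, P p -> P q -> P (p * q)) -> forall p, P p.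
Proof.
move=> PC PX PD PM p; rewrite [p]mpolyE; apply: (big_ind P); first by rewrite -mpolyC0; apply: PC.
  exact: PD.
move=> m _; rewrite -mul_mpolyC; apply: (PM) => //; rewrite mpolyXE_id.
apply: (big_ind P); [by rewrite -mpolyC1; apply: PC | exact: PM |].
move=> i _; elim: (m i) => [|e IHe]; first by rewrite expr0 -mpolyC1; apply: PC.
by rewrite exprS; apply: PM.
Qed.

Lemma mpoly_linear_ind (P : R -> Prop) :
  (forall m, P 'X_[m]) -> (forall c p q, P p -> P q -> P (c *: p + q)) ->
  forall p, P p.
Proof.
move=> PX PD p; rewrite [p]mpolyE; elim: (msupp p) => [|m s IH].
  by rewrite big_nil -(addNr 'X_[0%MM]) -scaleN1r; apply: (PD).
by rewrite big_cons; apply: (PD).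
Qed.

End MPolyInd.

Section MPolyGeneral.
Variables (n : nat) (K : comNzRingType).
Local Notation R := {mpoly K[n]}.

(** Telescoping: on a product, pq - p'q' = (p - p')q + p'(q - q'). The later divisions by a linear
    form, by the lines through a point and by the variables are instances. *)
Lemma comp_mpoly_sub (lq : n.-tuple R) (p : R) :
  exists q : 'I_n -> R, p - (p \mPo lq) = \sum_j q j * ('X_j - tnth lq j).
Proof.
elim/mpoly_alg_ind: p => [c|i|p q [a Ea] [b Eb]|p q [a Ea] [b Eb]].
- exists (fun=> 0); rewrite comp_mpolyC subrr.
  by rewrite big1 // => j _; rewrite mul0r.
- exists (fun j => (j == i)%:R); rewrite comp_mpolyXU.
  rewrite (bigD1 i) //= eqxx mul1r -tnth_nth big1 ?addr0 // => j /negbTE->.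
  by rewrite mul0r.
- exists (fun j => a j + b j); rewrite comp_mpolyD.
  under eq_bigr do rewrite mulrDl.
  by rewrite big_split /= -Ea -Eb; ring.
- exists (fun j => a j * q + (p \mPo lq) * b j).
  under eq_bigr do rewrite mulrDl -mulrA [q * _]mulrC mulrA -mulrA.
  under eq_bigr do rewrite -[_ * b _ * _]mulrA.
  rewrite big_split /= -mulr_sumr -Eb.
  have -> : \sum_(j < n) a j * (('X_j - tnth lq j) * q) = (p - (p \mPo lq)) * q.
    by rewrite Ea mulr_suml; apply: eq_bigr => j _; rewrite mulrA.
  by rewrite rmorphM /=; ring.
Qed.

Lemma mpoly_euler (d : nat) (p : R) : p \is d.-homog ->
  p *+ d = \sum_i 'X_i * p^`M(i).
Proof.
move=> /dhomogP hp; rewrite {1 2}[p]mpolyE.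
under [RHS]eq_bigr => i _ do rewrite raddf_sum mulr_sumr.
rewrite exchange_big /= -sumrMnl [LHS]big_seq [RHS]big_seq; apply: eq_bigr => m /hp <-.
under eq_bigr => i _ do rewrite mderivZ mderivX.
transitivity (\sum_(i < n) p@_m *: ('X_[m] *+ m i)).
  by rewrite -scaler_sumr sumrMnr -mdegE scalerMnr.
apply: eq_bigr => i _; rewrite -!scalerAr; congr (_ *: _).
rewrite scaler_nat -mpolyXD; case: (posnP (m i)) => [->|mi]; first by rewrite !mulr0n.
by rewrite addmC submK // lep1mP -lt0n.
Qed.

End MPolyGeneral.

Section HomogeneousComponents.
Variables (n : nat) (K : nzRingType).
Local Notation R := {mpoly K[n]}.

Lemma mcoeff_pihomog d (p : R) m :
  (pihomog mdeg d p)@_m = if mdeg m == d then p@_m else 0.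
Proof.
rewrite pihomogE raddf_sum /= {3}[p]mpolyE raddf_sum /= big_mkcond /=.
case: ifP => md; last first.
  rewrite big1 // => m' _; case: ifP => // /eqP m'd; rewrite mcoeffZ mcoeffX.
  case: eqP => [E|_]; last by rewrite mulr0.
  by rewrite -E m'd eqxx in md.
apply: eq_bigr => m' _; rewrite mcoeffZ mcoeffX.
case: ifP => // /eqP m'd; case: eqP => [E|_]; last by rewrite mulr0.
by case: m'd; rewrite E; apply/eqP.
Qed.

Lemma pihomogMr N e (p q : R) : q \is e.-homog ->
  pihomog mdeg N (p * q) = if (e <= N)%N then pihomog mdeg (N - e) p * q else 0.
Proof.
move=> qe; rewrite [p]mpolyE mulr_suml !raddf_sum /= mulr_suml.
case: leqP => le_eN; last first.
  rewrite big1 // => m _; rewrite -scalerAl linearZ /=.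
  rewrite (@pihomog_ne0 _ _ _ (mdeg m + e)) ?scaler0 //.
    by rewrite neq_ltn orbC (leq_trans le_eN) // leq_addl.
  by rewrite dhomogM // dhomogX.
apply: eq_bigr => m _; rewrite !linearZ /= -!scalerAl linearZ /=; congr (_ *: _).
rewrite pihomogX; have h : 'X_[m] * q \is (mdeg m + e).-homog by rewrite dhomogM // dhomogX.
case: eqP => [E|ne]; first by apply: pihomog_dE; rewrite -(subnK le_eN) -E.
rewrite mul0r; apply: pihomog_ne0 h; apply/eqP => E; apply: ne.
by rewrite -E addnK.
Qed.

End HomogeneousComponents.

(** * Elimination of a variable *)

Section PthRoot.
Variables (n : nat) (K : closedFieldType) (p : nat).
Hypothesis pK : p \in [pchar K].
Local Notation R := {mpoly K[n]}.

(** Vanishing derivatives make every exponent in the support divisible by p, the coefficients have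
    p-th roots because K is algebraically closed, and Frobenius is additive. *)
Lemma mpoly_pth_root (g : R) :
  (forall j, g^`M(j) = 0) -> exists h : R, g = h ^+ p.
Proof.
move=> dg.
have p_gt0 : (0 < p)%N by rewrite prime_gt0 // (pcharf_prime pK).
have pR : p \in [pchar R].
  by rewrite inE (pcharf_prime pK) -mpolyC_nat (pcharf0 pK) mpolyC0 eqxx.
have rt (a : K) : exists b, b ^+ p == a.
  have : size ('X^p - a%:P) != 1%N by rewrite size_XnsubC // eqSS -lt0n.
  case/closed_rootP=> b; rewrite rootE !hornerE subr_eq0 => eb; by exists b.
have dvd m j : m \in msupp g -> (p %| m j)%N.
  rewrite mcoeff_msupp => gm; case: (posnP (m j)) => [->|mj]; first exact: dvdn0.
  have := mcoeff_deriv j (m - U_(j))%MM g.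
  rewrite dg mcoeff0 submK ?lep1mP -?lt0n // mnmBE mnm1E eqxx subn1 prednK //.
  by move/esym/eqP; rewrite -mulr_natr mulf_eq0 (negbTE gm) /= -(dvdn_pcharf pK).
pose md (m : 'X_{1..n}) := [multinom (m j %/ p)%N | j < n].
exists (\sum_(m <- msupp g) xchoose (rt g@_m) *: 'X_[md m]).
rewrite -(pFrobenius_autE pR) raddf_sum /= {1}[g]mpolyE.
rewrite big_seq [RHS]big_seq; apply: eq_bigr => m gm.
rewrite pFrobenius_autE exprZn (eqP (xchooseP (rt _))) mpolyXn; congr (_ *: 'X_[_]).
by apply/mnmP => j; rewrite mulmnE mnmE divnK // dvd.
Qed.

End PthRoot.

Lemma map_mderivM (n : nat) (K : comNzRingType) (j : 'I_n) (P Q : {poly {mpoly K[n]}}) :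
  map_poly (mderiv j) (P * Q) =
  map_poly (mderiv j) P * Q + P * map_poly (mderiv j) Q.
Proof.
apply/polyP => e; rewrite coefD coef_map !coefM raddf_sum -big_split /=.
by apply: eq_bigr => l _; rewrite mderivM !coef_map.
Qed.

Section Univariate.
Variables (n : nat) (K : fieldType) (i : 'I_n.+1).
Local Notation R := {mpoly K[n.+1]}.
Local Notation A := {mpoly K[n]}.

(** X_i becomes the indeterminate of A[X] and the other variables become constants of A; [to_uni]
    and [of_uni] are then inverse isomorphisms, which makes one-variable division available. *)
Definition uni_var (j : 'I_n.+1) : {poly A} :=
  oapp (fun j' => ('X_j')%:P) 'X (unlift i j).

Definition to_uni (p : R) : {poly A} := mmap (polyC \o @mpolyC n K) uni_var p.
HB.instance Definition _ := GRing.RMorphism.copy to_uni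
  (mmap (polyC \o @mpolyC n K) uni_var).

Definition insert_var (a : A) : R := a \mPo [tuple 'X_(lift i j) | j < n].
HB.instance Definition _ := GRing.RMorphism.copy insert_var
  (comp_mpoly [tuple 'X_(lift i j) | j < n]).

Definition of_uni (P : {poly A}) : R := (map_poly insert_var P).['X_i].
HB.instance Definition _ := GRing.RMorphism.copy of_uni
  (horner_eval 'X_i \o map_poly insert_var).

Lemma to_uniD : {morph to_uni : p q / p + q}. Proof. exact: rmorphD. Qed.
Lemma to_uniM : {morph to_uni : p q / p * q}. Proof. exact: rmorphM. Qed.
Lemma of_uniD : {morph of_uni : p q / p + q}. Proof. exact: rmorphD. Qed.
Lemma of_uniM : {morph of_uni : p q / p * q}. Proof. exact: rmorphM. Qed.

Lemma to_uniC c : to_uni c%:MP = (c%:MP)%:P.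
Proof. exact: mmapC. Qed.

Lemma to_uniX j : to_uni 'X_j = uni_var j.
Proof. by rewrite /to_uni mmapX mmap1U. Qed.

Lemma insert_varC c : insert_var c%:MP = c%:MP.
Proof. exact: comp_mpolyC. Qed.

Lemma insert_varX j : insert_var 'X_j = 'X_(lift i j).
Proof. by rewrite /insert_var comp_mpolyXU -tnth_nth tnth_mktuple. Qed.

Lemma to_uni_insert a : to_uni (insert_var a) = a%:P.
Proof.
elim/mpoly_alg_ind: a => [c|j|p q Ep Eq|p q Ep Eq].
- by rewrite insert_varC to_uniC.
- by rewrite insert_varX to_uniX /uni_var liftK.
- by rewrite rmorphD rmorphD /= Ep Eq polyCD.
- by rewrite rmorphM rmorphM /= Ep Eq polyCM.
Qed.

Lemma insert_var_eq0 a : (insert_var a == 0) = (a == 0).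
Proof.
apply/eqP/eqP => [/(congr1 to_uni)|->]; last by rewrite rmorph0.
by rewrite to_uni_insert rmorph0 => /eqP; rewrite polyC_eq0 => /eqP.
Qed.

Lemma msupp_insert_var a m : m \in msupp (insert_var a) -> m i = 0%N.
Proof.
elim/mpoly_alg_ind: a m => [c|j|p q Ep Eq|p q Ep Eq] m.
- rewrite insert_varC msuppC; case: ifP => //= _; rewrite inE => /eqP->.
  by rewrite mnm0E.
- by rewrite insert_varX msuppX inE => /eqP->; rewrite mnm1E eq_sym (negbTE (neq_lift i j)).
- rewrite rmorphD /= => /msuppD_le; rewrite mem_cat => /orP[/Ep|/Eq] //.
- rewrite rmorphM /= => /msuppM_le /allpairsP[[m1 m2] /= [/Ep m1i /Eq m2i ->]].
  by rewrite mnmDE m1i m2i.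
Qed.

Lemma to_uniK : cancel to_uni of_uni.
Proof.
move=> p; elim/mpoly_alg_ind: p => [c|j|p q Ep Eq|p q Ep Eq].
- by rewrite to_uniC /of_uni map_polyC /= insert_varC hornerC.
- rewrite to_uniX /uni_var; case: (unliftP i j) => [j' ->|->] /=.
    by rewrite /of_uni map_polyC /= insert_varX hornerC.
  by rewrite /of_uni map_polyX hornerX.
- by rewrite to_uniD of_uniD; congr (_ + _).
- by rewrite to_uniM of_uniM; congr (_ * _).
Qed.

Lemma of_uniK : cancel of_uni to_uni.
Proof.
move=> P; elim/poly_ind: P => [|P a EP].
  by rewrite !rmorph0.
have X : of_uni 'X = 'X_i by rewrite /of_uni map_polyX hornerX.
have C b : of_uni b%:P = insert_var b by rewrite /of_uni map_polyC hornerC.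
by rewrite of_uniD of_uniM to_uniD to_uniM X C EP to_uniX to_uni_insert /uni_var unlift_none.
Qed.

Lemma to_uni_inj : injective to_uni. Proof. exact: can_inj to_uniK. Qed.

Lemma to_uni_eq0 p : (to_uni p == 0) = (p == 0).
Proof. by rewrite -(inj_eq to_uni_inj) rmorph0. Qed.

Lemma to_uni_deriv p : to_uni p^`M(i) = (to_uni p)^`().
Proof.
elim/mpoly_alg_ind: p => [c|j|p q Ep Eq|p q Ep Eq].
- by rewrite mderivC to_uniC derivC rmorph0.
- rewrite mderivX mnm1E to_uniX /uni_var; case: (unliftP i j) => [j' ->|->] /=.
    by rewrite eq_sym (negbTE (neq_lift i j')) scale0r rmorph0 derivC.
  rewrite eqxx scale1r derivX; suff -> : (U_(i) - U_(i) = 0)%MM by rewrite mpolyX0 rmorph1.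
  by apply/mnmP => l; rewrite mnmBE subnn mnm0E.
- by rewrite mderivD !to_uniD derivD Ep Eq.
- by rewrite mderivM to_uniD !to_uniM derivM Ep Eq.
Qed.

Lemma to_uni_mderiv_lift j p : to_uni p^`M(lift i j) = map_poly (mderiv j) (to_uni p).
Proof.
elim/mpoly_alg_ind: p => [c|j1|p q Ep Eq|p q Ep Eq].
- by rewrite mderivC to_uniC map_polyC /= mderivC rmorph0.
- rewrite mderivX mnm1E to_uniX /uni_var; case: (unliftP i j1) => [j' ->|->] /=.
    rewrite map_polyC /= mderivX mnm1E (inj_eq lift_inj).
    case: eqP => [->|_]; last by rewrite !scale0r rmorph0.
    rewrite !scale1r.
    suff E k (l : 'I_k) : (U_(l) - U_(l) = 0)%MM by rewrite !E !mpolyX0 rmorph1.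
    by apply/mnmP => j''; rewrite mnmBE subnn mnm0E.
  rewrite (negbTE (neq_lift i j)) scale0r rmorph0.
  apply/polyP => e; rewrite coef0 coef_map /= coefX.
  by case: eqP; rewrite ?mderiv0 // -mpolyC1 mderivC.
- by rewrite mderivD !to_uniD raddfD /= Ep Eq.
- rewrite mderivM to_uniD !to_uniM Ep Eq.
  by rewrite map_mderivM.
Qed.

End Univariate.

Lemma ex_minimal (T : Type) (w : T -> nat) (P : T -> Prop) :
  (exists x, P x) -> exists2 x, P x & forall y, P y -> (w x <= w y)%N.
Proof.
move=> [x Px]; elim/ltn_ind: {x}(w x) {-2}x (erefl (w x)) Px => m IH x wx Px.
case: (classic (exists2 y, P y & (w y < w x)%N)) => [[y Py lt_y]|no].
  by apply: (IH (w y) _ y) => //; rewrite -wx.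
exists x => // y Py; rewrite leqNgt; apply/negP => lt_y; apply: no; by exists y.
Qed.

(** * Divisibility in A[X] up to nonzero constants of a domain A *)

Section PseudoDivision.
Import Pdiv.Idomain.
Variable A : idomainType.
Implicit Types (F G g h : {poly A}).

Lemma dvdp_scale_mul g F : g %| F ->
  exists (c : A) (q : {poly A}), c != 0 /\ c *: F = q * g.
Proof. by case/dvdpP=> [[c q]] /= c0 E; exists c, q. Qed.

(** Here [%|] is divisibility over the fraction field of A, where ideals are principal: a nonzero
    element of least size in J generates, since pseudo-remainders stay in J. *)
Lemma pideal_generator (J : {poly A} -> Prop) F :
  J F -> F != 0 -> (forall a P Q, J P -> J Q -> J (a * P + Q)) ->
  exists G, [/\ J G, G != 0 & forall P, J P -> G %| P].
Proof.
move=> JF F0 JD.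
have [|G [JG G0] minG] := @ex_minimal _ (fun P : {poly A} => size P)
  (fun P => J P /\ P != 0); first by exists F.
have J0 : J 0 by have := JD (-1) _ _ JG JG; rewrite mulN1r addNr.
exists G; split=> // P JP; apply/modp_eq0P/eqP/negPn/negP => m0.
have JP' : J (P %% G).
  have -> : P %% G = - (P %/ G) * G + (lead_coef G ^+ scalp P G)%:P * P.
    by rewrite mul_polyC divp_eq; ring.
  apply: (JD) => //; rewrite -[_ * P]addr0; exact: JD.
by have := minG _ (conj JP' m0); rewrite leqNgt ltn_modpN0.
Qed.

(** Such a g is irreducible over the fraction field of A and takes the place of a prime factor of
    G. *)
Lemma minimal_factor G : (1 < size G)%N ->
  exists g, [/\ (1 < size g)%N, g %| G &
    forall h : {poly A}, (1 < size h)%N -> h %| g -> (size g <= size h)%N].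
Proof.
move=> G1; have [|g [g1 gG] ming] := @ex_minimal _ (fun P : {poly A} => size P)
  (fun P => (1 < size P)%N /\ P %| G); first by exists G.
exists g; split=> // h h1 hg; apply: ming; split=> //; exact: dvdp_trans gG.
Qed.

(* Division by a nonzero constant is allowed in [%|], whereas the hypothesis *)
(* and its conclusion are about exact divisibility.                          *)
Lemma reduced_squarefree F g : F != 0 ->
  (forall P, (exists Q, P ^+ 2 = Q * F) -> exists Q, P = Q * F) ->
  (1 < size g)%N -> ~~ (g * g %| F).
Proof.
move=> F0 redF g1; apply/negP => /dvdp_scale_mul[c [h [c0 E]]].
have [|Q EQ] := redF (h * g).
  by exists (c *: h); rewrite expr2 -scalerAl scalerAr E; ring.
have h0 : h != 0.
  apply: contraNneq F0 => h0; move: E; rewrite h0 mul0r => /eqP.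
  by rewrite -mul_polyC mulf_eq0 polyC_eq0 (negbTE c0).
have g0 : g != 0 by rewrite -size_poly_gt0 ltnW.
have Q0 : Q != 0.
  by apply/eqP => Q0; move/eqP: EQ; rewrite Q0 mul0r mulf_eq0 (negbTE h0) (negbTE g0).
have := congr1 (fun P : {poly A} => size P) E; rewrite mulrA EQ size_scale //.
rewrite !size_mul ?mulf_neq0 //.
have := size_poly_gt0 Q; have := size_poly_gt0 F; rewrite F0 Q0; lia.
Qed.

Lemma dvdp_size_scale g P : g != 0 -> g %| P -> (size P <= size g)%N ->
  exists c b, c != 0 /\ c *: P = b *: g.
Proof.
move=> g0 /dvdp_scale_mul[c [q [c0 E]]] szP; exists c, q`_0; split=> //.
rewrite E -mul_polyC -size1_polyC //.
case: (eqVneq q 0) => [->|q0]; first by rewrite size_poly0.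
move: szP; rewrite -(size_scale P c0) E size_mul //.
by have := size_poly_gt0 q; have := size_poly_gt0 g; rewrite q0 g0; lia.
Qed.

Lemma minimal_factor_not_exp g h e : (1 < size g)%N ->
  (forall d : {poly A}, (1 < size d)%N -> d %| g -> (size g <= size d)%N) ->
  forall a, a != 0 -> a *: g <> h ^+ e.+2.
Proof.
move=> g1 ming a a0 E; have := size_exp h e.+2; rewrite -E size_scale // => szg.
have hg : h %| g by rewrite -(dvdpZr _ _ a0) E exprS dvdp_mulIl.
have h1 : (1 < size h)%N by lia.
by have := ming _ h1 hg; nia.
Qed.

Lemma minimal_coprime g h : (1 < size g)%N ->
  (forall d : {poly A}, (1 < size d)%N -> d %| g -> (size g <= size d)%N) ->
  ~~ (g %| h) -> coprimep g h.
Proof.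
move=> g1 ming; apply: contraR; rewrite coprimep_def => s1.
have g0 : g != 0 by rewrite -size_poly_gt0 ltnW.
have s2 : (1 < size (gcdp g h))%N.
  by rewrite ltn_neqAle eq_sym s1 size_poly_gt0 gcdp_eq0 negb_and g0.
have := ming _ s2 (dvdp_gcdl g h) => le_s.
have /eqp_dvdl <- : gcdp g h %= g.
  by rewrite -dvdp_size_eqp ?dvdp_gcdl // eqn_leq le_s dvdp_leq // dvdp_gcdl.
exact: dvdp_gcdr.
Qed.

(** Up to a constant F = h g, with h prime to g by minimality. Modulo g, the derivative D F reduces
    to h D g, and Gauss's lemma removes h. *)
Lemma minimal_factor_dvd_deriv (D : {additive {poly A} -> {poly A}}) F g :
  (forall P Q, D (P * Q) = D P * Q + P * D Q) ->
  (1 < size g)%N -> (forall d : {poly A}, (1 < size d)%N -> d %| g -> (size g <= size d)%N) ->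
  g %| F -> ~~ (g * g %| F) -> g %| D F -> g %| D g.
Proof.
move=> DM g1 ming gF nggF gDF; have [c [h [c0 E]]] := dvdp_scale_mul gF.
have ngh : ~~ (g %| h).
  apply: contra nggF => gh; rewrite -(dvdpZr _ _ c0) E.
  exact: dvdp_mul.
have /(Gauss_dvdpr (D g)) <- := minimal_coprime g1 ming ngh.
move/(congr1 D): E; rewrite -mul_polyC !DM => E.
have -> : h * D g = D c%:P * F + c%:P * D F - D h * g by rewrite E; ring.
by rewrite -mulNr !dvdp_add ?dvdp_mull.
Qed.

End PseudoDivision.

Lemma mderiv_exp (n : nat) (K : comNzRingType) (j : 'I_n) (p : {mpoly K[n]}) e :
  (p ^+ e.+1)^`M(j) = (p ^+ e * p^`M(j)) *+ e.+1.
Proof.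
elim: e => [|e IH]; first by rewrite expr1 expr0 mul1r.
by rewrite exprS mderivM IH exprS -mulr_natr -[RHS]mulr_natr; ring.
Qed.

Section Elimination.
Import Pdiv.Idomain.
Variables (n : nat) (K : closedFieldType) (i : 'I_n.+1).
Local Notation R := {mpoly K[n.+1]}.
Local Notation A := {mpoly K[n]}.

(** For degree reasons g' = 0, so the characteristic is a prime p. A derivation of the coefficients
    does not raise the degree, so it multiplies g by the logarithmic derivative of the leading
    coefficient l. Hence l^(p-1) g is killed by all derivations and is a p-th power, which a minimal
    factor cannot be. *)
Lemma minimal_not_all_deriv (g : {poly A}) : (1 < size g)%N ->
  (forall d : {poly A}, (1 < size d)%N -> d %| g -> (size g <= size d)%N) ->
  g %| g^`() -> (forall j, g %| map_poly (mderiv j) g) -> False.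
Proof.
move=> g1 ming gDg gDjg; set s := (size g).-1.
have g0 : g != 0 by rewrite -size_poly_gt0 ltnW.
have dg0 : g^`() = 0.
  apply/eqP/negPn/negP => nz; have := dvdp_leq nz gDg.
  by rewrite leqNgt lt_size_deriv.
set l := lead_coef g; have l0 : l != 0 by rewrite lead_coef_eq0.
have gs : g`_s = l by [].
have s_gt0 : (0 < s)%N by rewrite /s -subn1 subn_gt0.
have [p pK] : exists p, p \in [pchar K].
  suff sK : s%:R == 0 :> K by have [p pK] := natf0_pchar s_gt0 sK; exists p.
  have := coef_deriv g s.-1; rewrite dg0 coef0 prednK // gs.
  move/esym/eqP; rewrite -[l *+ s]mulr_natr mulf_eq0 (negbTE l0) /=.
  by rewrite -mpolyC_nat mpolyC_eq0.
have p_gt1 : (1 < p)%N by rewrite prime_gt1 // (pcharf_prime pK).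
have Dlg j : l *: map_poly (mderiv j) g = (mderiv j l) *: g.
  have [c [b [c0 E]]] := dvdp_size_scale g0 (gDjg j) (size_poly _ _).
  have : (c *: map_poly (mderiv j) g)`_s = (b *: g)`_s by rewrite E.
  rewrite !coefZ coef_map /= gs => El.
  apply: (@mulfI _ c%:P); first by rewrite polyC_eq0.
  rewrite -!mul_polyC mulrCA [c%:P * _]mul_polyC E -mul_polyC mulrA [c%:P * _]mulrA -!polyCM El.
  by rewrite (mulrC l b).
have pred2 : p = p.-2.+2 by lia.
(* The coefficients of g / l are constants for all derivations, hence so are  *)
(* those of l ^ p * (g / l).                                                  *)
pose G2 : {poly A} := (l ^+ p.-1)%:P * g.
have lp0 : (l ^+ p.-1)%:P != 0 :> {poly A} by rewrite polyC_eq0 expf_neq0.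
have [h Eh] : exists h : R, of_uni i G2 = h ^+ p.
  apply: (mpoly_pth_root pK) => j; apply: (can_inj (@to_uniK _ K i)).
  rewrite rmorph0; case: (unliftP i j) => [j' ->|->].
    rewrite to_uni_mderiv_lift of_uniK /G2 map_mderivM map_polyC /=.
    have -> : p.-1 = p.-2.+1 by rewrite {1}pred2.
    have -> : mderiv j' (l ^+ p.-2.+1) = (l ^+ p.-2 * mderiv j' l) *+ p.-1.
      by rewrite mderiv_exp; congr (_ *+ _); lia.
    have -> : (l ^+ p.-2.+1)%:P * map_poly (mderiv j') g =
        (l ^+ p.-2 * mderiv j' l)%:P * g.
      rewrite exprSr [in LHS]polyCM -mulrA [l%:P * _]mul_polyC Dlg -mul_polyC.
      by rewrite mulrA -polyCM.
    rewrite -mulrDl -polyCD -mulrSr prednK ?(ltnW p_gt1) // -mulr_natr.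
    by rewrite -mpolyC_nat (pcharf0 pK) mpolyC0 mulr0 polyC0 mul0r.
  by rewrite to_uni_deriv of_uniK /G2 derivM derivC dg0 mulr0 mul0r addr0.
have {}Eh : G2 = (to_uni i h) ^+ p by rewrite -rmorphXn /= -Eh of_uniK.
move: (to_uni i h) Eh => H EH.
have {}EH : l ^+ p.-1 *: g = H ^+ p.-2.+2 by rewrite -pred2 -EH /G2 mul_polyC.
exact: minimal_factor_not_exp g1 ming _ (expf_neq0 _ l0) EH.
Qed.

(** Over the fraction field of A, f and its partial derivatives generate a principal ideal. If its
    generator had positive degree, a minimal factor g of it would divide f exactly once, f being
    reduced, and so g would divide all its own derivatives. The generator is therefore a nonzero
    constant, that is, free of X_i. *)
Theorem elimination (f : R) : f != 0 ->
  (forall (g : R) (e : nat), (exists q, g ^+ e = q * f) -> exists q, g = q * f) ->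
  exists2 a : A, a != 0 &
    exists u v, insert_var i a = u * f + \sum_j v j * f^`M(j).
Proof.
move=> f0 redf; pose F := to_uni i f.
have F0 : F != 0 by rewrite to_uni_eq0.
have redF P : (exists Q, P ^+ 2 = Q * F) -> exists Q, P = Q * F.
  move=> [Q EQ]; have [|q Eq] := redf (of_uni i P) 2.
    by exists (of_uni i Q); rewrite -rmorphXn /= EQ of_uniM to_uniK.
  by exists (to_uni i q); rewrite -to_uniM -Eq of_uniK.
pose J P := exists U V, P = U * F + \sum_j V j * to_uni i f^`M(j).
have [||a P Q [U [V ->]] [U' [V' ->]]|G [[U [V EG]] G0 GJ]] := @pideal_generator _ J F.
- exists 1, (fun=> 0); rewrite mul1r big1 ?addr0 // => j _; exact: mul0r.
- exact: F0.
- exists (a * U + U'), (fun j => a * V j + V' j).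
  under [in RHS]eq_bigr do rewrite mulrDl -mulrA.
  by rewrite big_split /= -mulr_sumr; ring.
case: (leqP (size G) 1) => szG.
  move: EG; rewrite (size1_polyC szG) => EG; exists G`_0.
    by rewrite -polyC_eq0 -size1_polyC.
  exists (of_uni i U), (fun j => of_uni i (V j)).
  apply: (can_inj (@to_uniK _ K i)); rewrite to_uni_insert EG.
  rewrite to_uniD to_uniM of_uniK rmorph_sum /=; congr (_ + _).
  by apply: eq_bigr => j _; rewrite to_uniM of_uniK.
have [g [g1 gG ming]] := minimal_factor szG.
exfalso; have gF : g %| F.
  apply: dvdp_trans gG (GJ _ _); exists 1, (fun=> 0).
  by rewrite mul1r big1 ?addr0 // => j _; exact: mul0r.
have gDF j : g %| to_uni i f^`M(j).
  apply: dvdp_trans gG (GJ _ _); exists 0, (fun l => (l == j)%:R).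
  rewrite mul0r add0r (bigD1 j) //= eqxx mul1r big1 ?addr0 // => l /negbTE->.
  exact: mul0r.
have ngg := reduced_squarefree F0 redF g1.
apply: (minimal_not_all_deriv g1 ming) => [|j].
  apply: (@minimal_factor_dvd_deriv _ (@deriv A) F g) => //; first exact: derivM.
  by have := gDF i; rewrite to_uni_deriv.
apply: (@minimal_factor_dvd_deriv _ (map_poly (mderiv j)) F g) => //; first exact: map_mderivM.
by have := gDF (lift i j); rewrite to_uni_mderiv_lift.
Qed.

End Elimination.

(** * Bounded codimension of the gradient ideal *)

Section BoundedQuotient.
Variable (K : fieldType).
Local Notation R := {mpoly K[3]}.
Variable J : R -> Prop.
Hypothesis J0 : J 0.
Hypothesis JD : forall a p q, J p -> J q -> J (a * p + q).
Hypothesis Jh : forall p N, J p -> J (pihomog mdeg N p).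
Hypothesis Jc : forall i : 'I_3, exists c, [/\ J c, c != 0 &
  forall m, m \in msupp c -> m i = 0%N].

Lemma ideal_homog_elim (i : 'I_3) : exists c, [/\ J c, c != 0,
  c \is (mdeg (mlead c)).-homog & forall m, m \in msupp c -> m i = 0%N].
Proof.
have [c [Jci c0 ci]] := Jc i; set e := mdeg (mlead c).
have p0 : pihomog mdeg e c != 0.
  apply: contraNneq c0 => E; have := mcoeff_pihomog e c (mlead c).
  by rewrite E mcoeff0 eqxx => /esym/eqP; rewrite mleadc_eq0.
exists (pihomog mdeg e c); split=> //.
- exact: Jh.
- suff -> : mdeg (mlead (pihomog mdeg e c)) = e by exact: pihomogP.
  by apply: (dhomog_mf (pihomogP _ _ _)); exact: mlead_supp.
- move=> m; rewrite mcoeff_msupp mcoeff_pihomog; case: ifP => [_|]; last by rewrite eqxx.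
  by rewrite -mcoeff_msupp; exact: ci.
Qed.

Definition reduced_to (N : nat) (s : seq 'X_{1..3}) (p : R) :=
  exists q (c : 'X_{1..3} -> K),
    [/\ J q, q \is N.-homog & p = q + \sum_(m <- s) c m *: 'X_[m]].

Lemma reduced_toD N s a p q :
  reduced_to N s p -> reduced_to N s q -> reduced_to N s (a *: p + q).
Proof.
move=> [p1 [c [Jp hp ->]]] [q1 [c' [Jq hq ->]]].
exists (a *: p1 + q1), (fun m => a * c m + c' m); split.
- by rewrite -mul_mpolyC; apply: JD.
- by rewrite rpredD // rpredZ.
- under [in RHS]eq_bigr do rewrite scalerDl -scalerA.
  rewrite big_split /= -scaler_sumr scalerDr -!addrA; congr (_ + _).
  by rewrite addrCA.
Qed.

Lemma reduced_to_sum N s (p : R) :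
  (forall m, m \in msupp p -> reduced_to N s 'X_[m]) -> reduced_to N s p.
Proof.
move=> H; rewrite [p]mpolyE big_seq; apply: (big_ind (reduced_to N s)).
- exists 0, (fun=> 0); split=> //; first exact: rpred0.
  by rewrite big1 ?addr0 // => m _; rewrite scale0r.
- by move=> x y Hx Hy; rewrite -[x]scale1r; apply: reduced_toD.
- move=> m mp; rewrite -[_ *: _]addr0; apply: reduced_toD; first exact: H.
  exists 0, (fun=> 0); split=> //; first exact: rpred0.
  by rewrite big1 ?addr0 // => m' _; rewrite scale0r.
Qed.

(* The monomials of degree N with at most one exponent exceeding M: the index *)
(* x.1 of that exponent and the other two exponents determine the monomial.   *)
Definition thin_monomials (M N : nat) : seq 'X_{1..3} :=
  undup [seq m <- [seq [multinom if j == x.1 then (N - \sum_(l | l != x.1) x.2 l)%N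
                  else x.2 j | j < 3] | x : 'I_3 * {ffun 'I_3 -> 'I_M.+1}] | mdeg m == N].

Lemma size_thin_monomials M N : (size (thin_monomials M N) <= 3 * M.+1 ^ 3)%N.
Proof.
rewrite (leq_trans (size_undup _)) // size_filter (leq_trans (count_size _ _)) // size_map -cardE.
by rewrite card_prod card_ffun !card_ord.
Qed.

Lemma mem_thin_monomials M N (m : 'X_{1..3}) i : mdeg m = N ->
  (forall j, j != i -> m j <= M)%N -> m \in thin_monomials M N.
Proof.
move=> mN mM; rewrite mem_undup mem_filter mN eqxx /=.
apply/mapP; exists (i, [ffun j => inord (m j)]); first by rewrite mem_enum.
have E j : j != i -> ([ffun j => inord (m j)] : {ffun 'I_3 -> 'I_M.+1}) j = m j :> nat.
  by move=> ji; rewrite ffunE inordK // ltnS mM.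
apply/mnmP => j; rewrite mnmE /=; case: eqVneq => [->|ji]; last by rewrite E.
by rewrite (eq_bigr (fun l => m l)) // -mN mdegE (bigD1 i) //= addnK.
Qed.

(** M bounds the degrees of the three forms of J that each omit one variable. A monomial that is not
    thin has two exponents beyond M, so it is a multiple of the leading monomial of the form in
    these two variables; subtracting the multiple leaves smaller monomials. *)
Lemma monomial_reduction : exists M, forall N m, mdeg m = N ->
  reduced_to N (thin_monomials M N) 'X_[m].
Proof.
have [c cP] := fun_choice ideal_homog_elim.
pose M := (\max_i mdeg (mlead (c i)))%N; exists M => N m.
elim/(well_founded_induction (@ltom_wf 3)): m => m IH mN.
case: (boolP [exists i : 'I_3, [forall j, (j != i) ==> (m j <= M)%N]]).
  move=> /existsP[i /forallP mi]; exists 0, (fun m' => (m' == m)%:R); split=> //.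
    exact: rpred0.
  have thin_m : m \in thin_monomials M N.
    by apply: (@mem_thin_monomials _ _ m i) => // j; apply/implyP.
  rewrite add0r (bigD1_seq m) ?undup_uniq //= eqxx scale1r big1 ?addr0 //.
  by move=> m' /negbTE->; rewrite scale0r.
rewrite negb_exists => /forallP nothin.
(* No index is the only one with a large exponent; using this twice yields two distinct such
   indices. *)
have far i : exists2 j, j != i & (M < m j)%N.
  have := nothin i; rewrite negb_forall => /existsP[j].
  by rewrite negb_imply -ltnNge => /andP[ji Mj]; exists j.
have [j1 _ Mj1] := far ord0; have [j2 j21 Mj2] := far j1.
have /cards1P[i3 Ei3] : #|~: [set j1; j2]| == 1%N.
  by have := cardsC [set j1; j2]; rewrite cards2 eq_sym j21 card_ord => /eqP.
have {Ei3}j3 l : l != i3 -> l = j1 \/ l = j2.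
  move=> l3; have : l \notin ~: [set j1; j2] by rewrite Ei3 inE.
  by rewrite in_setC negbK !inE => /orP[/eqP|/eqP]; [left|right].
have [Jc3 c30 hc3 fc3] := cP i3; set C := c i3 in Jc3 c30 hc3 fc3; set l := mlead C.
have lm : (l <= m)%MM.
  have lM : (mdeg l <= M)%N by rewrite /M (bigD1 i3) //= leq_max leqnn.
  have lj j : (l j <= mdeg l)%N by rewrite mdegE (bigD1 j) //= leq_addr.
  apply/mnm_lepP => j; case: (eqVneq j i3) => [->|/j3 j_cases].
    by rewrite fc3 // mlead_supp.
  apply: leq_trans (lj j) (leq_trans lM _).
  by case: j_cases => ->; exact: ltnW.
have deg_ml : (mdeg (m - l)%MM + mdeg l)%N = N by rewrite -mdegD submK.
pose P := 'X_[m - l] * ((C@_l)^-1 *: C); have C_l : C@_l != 0 by rewrite mleadc_eq0.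
have hP : P \is N.-homog by rewrite -deg_ml dhomogM ?dhomogX // dhomogZ.
have JP : J P.
  rewrite /P -mul_mpolyC mulrA -[_ * C]addr0; exact: JD.
have -> : 'X_[m] = 1 *: P + ('X_[m] - P) by rewrite scale1r addrC subrK.
apply: reduced_toD.
  exists P, (fun=> 0); split=> //; rewrite big1 ?addr0 // => m' _; exact: scale0r.
apply: reduced_to_sum => m' m'P; apply: IH; last first.
  by apply: (dhomog_mf _ m'P); rewrite rpredB // dhomogX; apply/eqP.
have m'E : m' \in msupp P -> (m' <= m)%O.
  move/msuppM_le/allpairsP=> [[m1 m2] /= []].
  rewrite msuppX inE => /eqP-> /msuppZ_le /msupp_le_mlead le ->.
  by rewrite -{2}(submK lm) lemc_add2r.
rewrite Order.POrderTheory.lt_neqAle; apply/andP; split; last first.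
  by move/msuppB_le: m'P; rewrite mem_cat msuppX inE => /orP[/eqP->|].
apply: contraTneq m'P => ->; rewrite -mcoeff_eq0 mcoeffB mcoeffX eqxx /P mulrC.
by rewrite -{1}(submK lm) mcoeffMX mcoeffZ mulVf // subrr.
Qed.

Lemma bounded_quotient : exists B, forall N, exists2 s : seq 'X_{1..3},
  (size s <= B)%N & {in s, forall m, mdeg m = N} /\
  forall p : R, p \is N.-homog -> reduced_to N s p.
Proof.
have [M HM] := monomial_reduction; exists (3 * M.+1 ^ 3)%N => N.
exists (thin_monomials M N); first exact: size_thin_monomials.
split=> [m|p hp]; first by rewrite mem_undup mem_filter => /andP[/eqP].
by apply: reduced_to_sum => m mp; apply: HM; apply: (dhomog_mf hp).
Qed.

End BoundedQuotient.

(** Linearity is assumed on U only, because a cokernel isomorphism is constrained on syzygies only;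
    precomposing with the projection onto U gives a linear map everywhere. *)
Lemma rank_nullity_in (K : fieldType) (aT rT : vectType K) (U : {vspace aT})
    (F : aT -> rT) :
  (forall a, {in U &, forall u v, F (a *: u + v) = a *: F u + F v}) ->
  exists (N : {vspace aT}) (W : {vspace rT}),
    [/\ forall u, u \in N <-> u \in U /\ F u = 0,
        forall w, w \in W <-> exists2 u, u \in U & F u = w
      & (\dim N + \dim W)%N = \dim U].
Proof.
move=> Flin; pose G u := F (projv U u).
have Glin : linear G by move=> a u v; rewrite /G linearP Flin ?memv_proj.
pose GL : {linear aT -> rT} := HB.pack G (GRing.isLinear.Build K aT rT _ G Glin).
have GE u : u \in U -> linfun GL u = F u by move=> uU; rewrite lfunE /= /G projv_id.
exists (U :&: lker (linfun GL))%VS, (linfun GL @: U)%VS; split=> [u|w|].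
- rewrite memv_cap memv_ker; split=> [/andP[uU]|[uU Fu]].
    by rewrite GE // => /eqP.
  by rewrite uU GE // Fu eqxx.
- split=> [/memv_imgP[u uU ->]|[u uU <-]]; first by exists u; rewrite ?GE.
  by apply/memv_imgP; exists u; rewrite ?GE.
- exact: limg_ker_dim.
Qed.

Lemma rank_nullity (K : fieldType) (aT rT : vectType K) (F : aT -> rT) : linear F ->
  exists (N : {vspace aT}) (W : {vspace rT}),
    [/\ forall u, u \in N <-> F u = 0,
        forall w, w \in W <-> exists u, F u = w
      & (\dim N + \dim W)%N = dim aT].
Proof.
move=> Flin; have [|N [W [NE WE dE]]] := @rank_nullity_in _ _ _ fullv F.
  by move=> a u v _ _; exact: Flin.
exists N, W; split=> [u|w|]; last by rewrite dE dimvf.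
- by rewrite NE memvf; split=> // [[]].
- by rewrite WE; split=> [[u _ <-]|[u <-]]; exists u => //; exact: memvf.
Qed.

Lemma vspace_ext (K : fieldType) (vT : vectType K) (U V : {vspace vT}) :
  (forall u, u \in U <-> u \in V) -> U = V.
Proof. by move=> UV; apply/vspaceP => u; apply/idP/idP => /UV. Qed.

Section GradientIdeal.
Variables (k : closedFieldType) (d : nat) (f : {mpoly k[3]}).
Local Notation R := {mpoly k[3]}.
Hypothesis hhom : f \is d.+1.-homog.

Lemma dhomog_mderiv (i : 'I_3) : f^`M(i) \is d.-homog.
Proof.
apply/dhomogP => m; rewrite mcoeff_msupp mcoeff_deriv => nz.
have : (m + U_(i))%MM \in msupp f.
  by rewrite mcoeff_msupp; apply: contraNneq nz => ->; rewrite mul0rn.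
by move/(dhomog_mf hhom); rewrite /= mdegD mdeg1 addn1 => -[].
Qed.

Definition syz_sum (v : 'rV[R]_3) : R := \sum_(i < 3) v 0 i * f^`M(i).

Definition vcomp (n : nat) (v : 'rV[R]_3) : 'rV[R]_3 := \row_i pihomog mdeg n (v 0 i).

Lemma vcompP n v : vhomog n (vcomp n v).
Proof. by move=> i; rewrite mxE; exact: pihomogP. Qed.

Lemma pihomog_syz_sum n v : pihomog mdeg (n + d) (syz_sum v) = syz_sum (vcomp n v).
Proof.
rewrite raddf_sum /=; apply: eq_bigr => i _.
by rewrite (pihomogMr _ _ (dhomog_mderiv i)) leq_addl addnK mxE.
Qed.

Lemma pihomog_syz_sum_lt n v : (n < d)%N -> pihomog mdeg n (syz_sum v) = 0.
Proof.
move=> nd; rewrite raddf_sum /= big1 // => i _.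
by rewrite (pihomogMr _ _ (dhomog_mderiv i)) leqNgt nd.
Qed.

Lemma syz_sumD a u v : syz_sum (a *: u + v) = a * syz_sum u + syz_sum v.
Proof.
rewrite /syz_sum mulr_sumr -big_split /=; apply: eq_bigr => i _.
by rewrite !mxE mulrDl mulrA.
Qed.

Lemma SyzE v : (v \in Syz f) = (syz_sum v == 0). Proof. by []. Qed.

Lemma Syz_vcomp n v : v \in Syz f -> vcomp n v \in Syz f.
Proof. by rewrite !SyzE -pihomog_syz_sum => /eqP->; rewrite raddf0. Qed.

Lemma SyzD a u v : u \in Syz f -> v \in Syz f -> a *: u + v \in Syz f.
Proof. by rewrite !SyzE syz_sumD => /eqP-> /eqP->; rewrite mulr0 addr0. Qed.

Lemma Syz0 : 0 \in Syz f.
Proof. by rewrite SyzE /syz_sum big1 // => i _; rewrite mxE mul0r. Qed.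

Lemma SyzZ a u : u \in Syz f -> a *: u \in Syz f.
Proof. by move=> uS; rewrite -[_ *: _]addr0; apply: SyzD => //; exact: Syz0. Qed.

Lemma Syz_saturated a u : a != 0 -> a *: u \in Syz f -> u \in Syz f.
Proof.
move=> a0; rewrite !SyzE -[_ *: u]addr0 syz_sumD.
have /eqP -> : syz_sum 0 == 0 by rewrite -SyzE Syz0.
by rewrite addr0 mulf_eq0 (negbTE a0).
Qed.

Hypothesis hf0 : f != 0.
Hypothesis hchar : d.+1%:R != 0 :> k.
Hypothesis hred : reduced_form f.

(** By Euler's formula and the invertibility of d + 1, f lies in J_f. So [elimination] puts into
    J_f, for each i, a nonzero polynomial free of X_i, as [bounded_quotient] requires. *)
Lemma gradient_quotient_bounded : exists B, forall n, exists2 s : seq 'X_{1..3},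
  (size s <= B)%N & {in s, forall m, mdeg m = (n + d)%N} /\
  forall p : R, p \is (n + d).-homog ->
    exists (v : 'rV[R]_3) (c : 'X_{1..3} -> k), vhomog n v /\
      p = syz_sum v + \sum_(m <- s) c m *: 'X_[m].
Proof.
have [||||B HB] := @bounded_quotient k (gradient_ideal f).
- by exists 0; rewrite big1 // => i _; rewrite mxE mul0r.
- by move=> a p q [u ->] [v ->]; exists (a *: u + v); rewrite -[RHS]/(syz_sum _) syz_sumD.
- move=> p N [v ->]; case: (ltnP N d) => Nd.
    exists 0; rewrite -/(syz_sum v) pihomog_syz_sum_lt // big1 // => i _.
    by rewrite mxE mul0r.
  by exists (vcomp (N - d) v); rewrite -/(syz_sum v) -/(syz_sum (vcomp _ _)) -pihomog_syz_sum subnK.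
- move=> i; have [a a0 [u [v E]]] := @elimination 2 k i f hf0 hred.
  exists (insert_var i a); split; last exact: msupp_insert_var.
    have fE : f = (d.+1%:R^-1)%:MP * \sum_j 'X_j * f^`M(j).
      by rewrite -(mpoly_euler hhom) mul_mpolyC -scaler_nat scalerA mulVf // scale1r.
    exists (\row_j (u * ((d.+1%:R^-1)%:MP * 'X_j) + v j)).
    rewrite E {1}fE !mulr_sumr -big_split /=; apply: eq_bigr => j _.
    by rewrite mxE mulrDl !mulrA.
  by rewrite insert_var_eq0.
exists B => n; have [s sB [sn Hs]] := HB (n + d)%N; exists s => //; split=> // p hp.
have [q [c [[v Ev] hq Ep]]] := Hs p hp; exists (vcomp n v), c; split.
  exact: vcompP.
by rewrite -pihomog_syz_sum /syz_sum -Ev pihomog_dE.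
Qed.

End GradientIdeal.

(** * Hilbert functions of Bourbaki ideals *)

Lemma dim_dhomog (K : fieldType) n : dim (dhomog 3 K n) = 'C(n + 2, n).
Proof. by []. Qed.

Lemma hilbert_functionP (K : fieldType) (I : {pred {mpoly K[3]}}) n
    (W : {vspace dhomog 3 K n}) :
  (forall p : dhomog 3 K n, p \in W <-> (p : {mpoly K[3]}) \in I) ->
  forall h, hilbert_function I n h <-> h = ('C(n + 2, n) - \dim W)%N.
Proof.
move=> WI h; split=> [[U UI ->]|->].
  by rewrite dimvf dim_dhomog; congr (_ - \dim _)%N; apply: vspace_ext => p; rewrite WI UI.
exists W; last by rewrite dimvf.
by move=> p; apply/idP/idP => /WI.
Qed.

Section SyzygyDimension.
Variables (k : closedFieldType) (d : nat) (f : {mpoly k[3]}).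
Local Notation R := {mpoly k[3]}.
Hypothesis hhom : f \is d.+1.-homog.

Definition row_of n (t : {ffun 'I_3 -> dhomog 3 k n}) : 'rV[R]_3 := \row_i (t i : R).

Lemma row_of_vhomog n (t : {ffun 'I_3 -> dhomog 3 k n}) : vhomog n (row_of t).
Proof. by move=> i; rewrite mxE; exact: dhomog_is_dhomog. Qed.

Lemma row_of_surj n (v : 'rV[R]_3) : vhomog n v -> exists t, v = @row_of n t.
Proof.
move=> hv; exists [ffun i => DHomog (hv i)]; apply/rowP => i.
by rewrite !mxE ffunE.
Qed.

Lemma row_ofP n a (t u : {ffun 'I_3 -> dhomog 3 k n}) :
  row_of (a *: t + u) = a%:MP *: row_of t + row_of u.
Proof.
apply/rowP => i; rewrite !mxE !ffunE linearP /=.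
by rewrite mul_mpolyC.
Qed.

Lemma row_of_inj n : injective (@row_of n).
Proof.
move=> t u /rowP tu; apply/ffunP => i; apply: val_inj.
by have := tu i; rewrite !mxE.
Qed.

Lemma syz_sum_homog n v : vhomog n v -> syz_sum f v \is (n + d).-homog.
Proof.
by move=> hv; apply: rpred_sum => i _; apply: dhomogM (hv i) (dhomog_mderiv hhom i).
Qed.

Definition syz_form n (t : {ffun 'I_3 -> dhomog 3 k n}) : dhomog 3 k (n + d) :=
  DHomog (syz_sum_homog (row_of_vhomog t)).

Lemma syz_form_linear n : linear (@syz_form n).
Proof.
move=> a t u; apply: val_inj => /=.
by rewrite row_ofP syz_sumD mul_mpolyC.
Qed.

Lemma Syz_dim n : exists (S : {vspace {ffun 'I_3 -> dhomog 3 k n}})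
    (W : {vspace dhomog 3 k (n + d)}),
  [/\ forall t, t \in S <-> row_of t \in Syz f,
      forall p : dhomog 3 k (n + d), p \in W <->
        exists2 v, vhomog n v & p = syz_sum f v :> R
    & (\dim S + \dim W = 3 * 'C(n + 2, n))%N].
Proof.
have [S [W [SE WE dSW]]] := rank_nullity (@syz_form_linear n).
exists S, W; split=> [t|p|].
- rewrite SE SyzE; split=> [/(congr1 val)/= ->|/eqP e]; first by rewrite eqxx.
  by apply: val_inj; rewrite /= e.
- rewrite WE; split=> [[t <-]|[v /row_of_surj[t ->] E]].
    by exists (row_of t); first exact: row_of_vhomog.
  by exists t; apply: val_inj; rewrite /= E.
- by rewrite dSW /dim /= card_ord.
Qed.

Lemma cokernel_iso_sum (phi : 'rV[R]_3 -> R) (T : Type) (s : seq T) (F : T -> 'rV[R]_3) :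
  (forall a u v, u \in Syz f -> v \in Syz f -> phi (a *: u + v) = a * phi u + phi v) ->
  (forall j, F j \in Syz f) ->
  \sum_(j <- s) F j \in Syz f /\ phi (\sum_(j <- s) F j) = \sum_(j <- s) phi (F j).
Proof.
move=> phiD FS; have phi0 : phi 0 = 0.
  have := phiD (-1) 0 0 (Syz0 f) (Syz0 f).
  by rewrite scaler0 addr0 mulN1r addNr.
elim: s => [|j s [IHS IH]]; first by rewrite !big_nil phi0; split=> //; exact: Syz0.
rewrite !big_cons -[F j]scale1r; split; first exact: SyzD.
by rewrite phiD // mul1r IH scale1r.
Qed.

(** Only the component of v of degree m + d' - e can have an image of degree m. This provides
    homogeneous lifts of the homogeneous elements of I. *)
Lemma pihomog_cokernel_iso (phi : 'rV[R]_3 -> R) e d' m v :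
  (forall a u v, u \in Syz f -> v \in Syz f -> phi (a *: u + v) = a * phi u + phi v) ->
  (forall n v, v \in Syz f -> vhomog n v ->
     ((d' <= n + e)%N -> phi v \is (n + e - d').-homog) /\
     ((n + e < d')%N -> phi v = 0)) ->
  v \in Syz f -> pihomog mdeg m (phi v) =
    if (e <= m + d')%N then phi (vcomp (m + d' - e) v) else 0.
Proof.
move=> phiD phih vS; pose N := ((m + d').+1 + \sum_i msize (v 0%R i))%N.
have Ev : v = \sum_(j < N) vcomp j v.
  apply/rowP => i; rewrite summxE {1}(@pihomog_partitionE _ _ mdeg N (v 0 i)).
    by apply: eq_bigr => j _; rewrite mxE.
  by rewrite /N (bigD1 i) //= addnCA leq_addr.
have compS (j : 'I_N) : vcomp j v \in Syz f by exact: (Syz_vcomp hhom).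
have [_ Ephi] := cokernel_iso_sum (index_enum 'I_N) phiD compS.
rewrite {1}Ev Ephi raddf_sum /=.
have other (j : 'I_N) : (j + e)%N <> (m + d')%N -> pihomog mdeg m (phi (vcomp j v)) = 0.
  move=> jm; have [h1 h2] := phih j _ (compS j) (vcompP _ _).
  case: (leqP d' (j + e)) => [/[dup] le_d /h1 hj|/h2->]; last exact: raddf0.
  by apply: pihomog_ne0 hj; apply/eqP; lia.
case: leqP => le_em; last first.
  by apply: big1 => j _; apply: other; lia.
have lt_jN : (m + d' - e < N)%N by rewrite /N; lia.
rewrite (bigD1 (Ordinal lt_jN)) //= big1 => [|j jm]; last first.
  apply: other => E; case/eqP: jm; apply: val_inj => /=; lia.
rewrite addr0; apply: pihomog_dE.
have [h1 _] := phih (m + d' - e)%N _ (compS (Ordinal lt_jN)) (vcompP _ _).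
have Em : (m + d' - e + e - d')%N = m by lia.
by move: h1; rewrite /= Em; apply; lia.
Qed.

(** This is the exact sequence 0 -> R_n -> S -> I_m -> 0, the first map being multiplication by eps.
    The shift d' is kept free because a nearly free resolution provides it as a1 + a2 - 1, not yet
    known to be d. *)
Lemma bourbaki_dim (I : {pred R}) eps e d' n m (S : {vspace {ffun 'I_3 -> dhomog 3 k (n + e)}}) :
  vhomog e eps -> eps != 0 -> eps \in Syz f ->
  cokernel_iso (Syz f) eps e d' I -> (m + d' = n + e + e)%N ->
  (forall t, t \in S <-> row_of t \in Syz f) ->
  exists W : {vspace dhomog 3 k m},
    (forall p : dhomog 3 k m, p \in W <-> (p : R) \in I) /\
    ('C(n + 2, n) + \dim W)%N = \dim S.
Proof.
move=> heps eps0 epsS [phi [phiD phiK phiI phih]] md SE.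
have hmul (a : dhomog 3 k n) i : (a : R) * eps 0 i \is (n + e).-homog.
  by apply: dhomogM; [exact: dhomog_is_dhomog | exact: heps].
pose E (a : dhomog 3 k n) := [ffun i => DHomog (hmul a i)].
have rowE a : row_of (E a) = (a : R) *: eps.
  by apply/rowP => i; rewrite !mxE ffunE.
have Elin : linear E.
  move=> a x y; apply: row_of_inj; rewrite row_ofP !rowE linearP /=.
  by rewrite scalerDl scalerA mul_mpolyC.
have [N [V [NE VE dNV]]] := rank_nullity Elin.
have N0 : \dim N = 0%N.
  apply/eqP; rewrite dimv_eq0 -subv0; apply/subvP => a /NE.
  move=> /(congr1 (@row_of _)); rewrite rowE memv0 => /rowP Ea.
  have [i ei] := rV_neq0 eps0.
  apply/eqP/val_inj; have := Ea i; rewrite !mxE ffunE /= => /eqP.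
  by rewrite mulf_eq0 (negbTE ei) orbF => /eqP.
pose G (t : {ffun 'I_3 -> dhomog 3 k (n + e)}) : dhomog 3 k m := indhomog m (phi (row_of t)).
have GE t : t \in S -> G t = phi (row_of t) :> R.
  move=> /SE tS; have [h _] := phih _ _ tS (row_of_vhomog t).
  rewrite /G /indhomog; apply: insubdK; have -> : m = (n + e + e - d')%N by lia.
  by apply: h; lia.
have Glin a : {in S &, forall t u, G (a *: t + u) = a *: G t + G u}.
  move=> t u tS uS; apply: val_inj; rewrite [LHS]GE; last by rewrite rpredD // rpredZ.
  rewrite row_ofP phiD; [|exact/SE|exact/SE].
  by rewrite mul_mpolyC linearP /= !GE.
have [N' [W [N'E WE dN'W]]] := rank_nullity_in Glin.
exists W; split=> [p|].
  rewrite WE phiI; split=> [[t tS <-]|[v vS Ev]].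
    by exists (row_of t); [exact/SE | rewrite GE].
  have [t Et] := row_of_surj (vcompP (n + e) v).
  have tS : t \in S by apply/SE; rewrite -Et; apply: (Syz_vcomp hhom).
  exists t => //; apply: val_inj; rewrite [LHS]GE // -Et /=.
  have := pihomog_cokernel_iso m phiD phih vS.
  rewrite md addnK leq_addl => <-; rewrite Ev.
  by apply: pihomog_dE; exact: dhomog_is_dhomog.
rewrite -dN'W; congr (_ + _)%N; rewrite -(dim_dhomog k) -dNV N0 add0n; congr (\dim _).
apply: vspace_ext => t; rewrite VE N'E; split=> [[a <-]|[tS /(congr1 val)]].
  have aS : row_of (E a) \in Syz f by rewrite rowE; exact: SyzZ.
  split; first exact/SE.
  apply: val_inj; rewrite /= [LHS]GE; last exact/SE.
  by apply/(phiK _ aS); exists (a : R); rewrite rowE.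
rewrite /= GE // => /(phiK _ _)[|a Ea]; first exact/SE.
exists (indhomog n (pihomog mdeg n a)); apply: row_of_inj; rewrite rowE.
rewrite insubdK; last exact: pihomogP.
apply/rowP => i; have /rowP/(_ i) := Ea; rewrite !mxE => Eai.
have := pihomogMr (n + e) a (heps i); rewrite -Eai leq_addl addnK => <-.
by apply: pihomog_dE; exact: dhomog_is_dhomog.
Qed.

End SyzygyDimension.

Lemma double_bin2 n : (2 * 'C(n + 2, n) = (n + 1) * (n + 2))%N.
Proof.
rewrite -{2}[n](addnK 2) bin_sub ?leq_addl // addn2 bin2 /= mul2n.
have := odd_double_half (n.+2 * n.+1); rewrite oddM /= negbK.
by case: (odd n); rewrite //= !add0n => ->; rewrite addn1 mulnC.
Qed.

(** The values a, b, a', b' are dim R in degrees n, m, n + e, n + e + d, while w = dim I_m and j =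
    dim J_f in degree n + e + d. In b + a + b' - 3a', which bounds b - w, the quadratic and linear
    terms in n cancel. *)
Lemma codim_bound_arith n m e d a b a' b' w j :
  (2 * a = (n + 1) * (n + 2))%N ->
  (2 * b = (m + 1) * (m + 2))%N ->
  (2 * a' = (n + e + 1) * (n + e + 2))%N ->
  (2 * b' = (n + e + d + 1) * (n + e + d + 2))%N ->
  (m + d = n + e + e)%N ->
  (a + w + j = 3 * a')%N ->
  (j <= b')%N ->
  (b <= w + (d + e) * (d + e))%N.
Proof.
move=> Ea Eb Ea' Eb' md E jb'.
have : ((m + d) * (m + d) = (n + e + e) * (n + e + e))%N by rewrite md.
have : ((m + d) * d = (n + e + e) * d)%N by rewrite md.
have := leq0n (d * d)%N; have := leq0n (e * d)%N; have := leq0n (e * e)%N.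
lia.
Qed.

(** With a free shift d' the same count gives b - w = (d - d') n up to an error independent of n.
    For n this large the value 1 is possible only if d' = d. *)
Lemma shift_arith B n m e d d' a b a' b' w j :
  (2 * a = (n + 1) * (n + 2))%N ->
  (2 * b = (m + 1) * (m + 2))%N ->
  (2 * a' = (n + e + 1) * (n + e + 2))%N ->
  (2 * b' = (n + e + d + 1) * (n + e + d + 2))%N ->
  (m + d' = n + e + e)%N ->
  (a + w + j = 3 * a')%N ->
  (j <= b' <= j + B)%N ->
  (w + 1 = b)%N ->
  (2 * (B + (d + d' + e + 2) * (d + d' + e + 2)) <= n)%N ->
  (d' = d)%N.
Proof.
move=> Ea Eb Ea' Eb' md E /andP[jb' bj'] wb nB.
have : ((m + d') * (m + d') = (n + e + e) * (n + e + e))%N by rewrite md.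
have : ((m + d') * d' = (n + e + e) * d')%N by rewrite md.
have : ((m + d') * d = (n + e + e) * d)%N by rewrite md.
have := leq0n (d * d)%N; have := leq0n (e * d)%N; have := leq0n (e * e)%N.
have := leq0n (d' * d')%N; have := leq0n (e * d')%N; have := leq0n (d * d')%N.
case: (ltngtP d' d) => // lt_d; exfalso.
  have : (n * d'.+1 <= n * d)%N by rewrite leq_mul2l lt_d orbT.
  lia.
have : (n * d.+1 <= n * d')%N by rewrite leq_mul2l lt_d orbT.
lia.
Qed.

Section HilbertFunctions.
Variables (k : closedFieldType) (d : nat) (f : {mpoly k[3]}).
Local Notation R := {mpoly k[3]}.
Hypothesis hhom : f \is d.+1.-homog.
Hypothesis hf0 : f != 0.
Hypothesis hchar : d.+1%:R != 0 :> k.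
Hypothesis hred : reduced_form f.

Lemma Syz_dim_bounds : exists B, forall n,
  exists (S : {vspace {ffun 'I_3 -> dhomog 3 k n}}) (j : nat),
  [/\ forall t, t \in S <-> row_of t \in Syz f,
      (\dim S + j = 3 * 'C(n + 2, n))%N
    & (j <= 'C(n + d + 2, n + d) <= j + B)%N].
Proof.
have [B HB] := gradient_quotient_bounded hhom hf0 hchar hred.
exists B => n; have [S [W [SE WE dSW]]] := Syz_dim hhom n.
exists S, (\dim W); split=> //; have [s sB [sn Hs]] := HB n.
rewrite -(dim_dhomog k) -dimvf dimvS ?subvf //=.
pose X := [seq (indhomog (n + d) 'X_[m] : dhomog 3 k (n + d)) | m <- s].
have full : (fullv <= W + <<X>>)%VS.
  apply/subvP => p _; have [v [c [hv Ep]]] := Hs _ (dhomog_is_dhomog p).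
  have Xm m : m \in s -> indhomog (n + d) 'X_[m] = 'X_[m] :> R.
    by move=> ms; apply: insubdK; rewrite dhomogX; apply/eqP; exact: sn.
  have -> : p = DHomog (syz_sum_homog hhom hv) +
      \sum_(m <- s) c m *: (indhomog (n + d) 'X_[m] : dhomog 3 k (n + d)).
    apply: val_inj; rewrite raddfD raddf_sum /= {1}Ep; congr (_ + _).
    by rewrite big_seq [RHS]big_seq; apply: eq_bigr => m ms; congr (_ *: _); rewrite Xm.
  apply: memv_add; first by apply/WE; exists v.
  rewrite big_seq; apply: memv_suml => m ms; apply: memvZ; apply: memv_span.
  exact: map_f.
apply: leq_trans (dimvS full) _; apply: leq_trans (dimv_add_leqif _ _).1 _.
by rewrite leq_add2l (leq_trans (dim_span _)) // size_map.
Qed.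

Lemma bourbaki_codim_bounds : exists B, forall (I : {pred R}) eps e d' n m,
  vhomog e eps -> eps != 0 -> eps \in Syz f -> cokernel_iso (Syz f) eps e d' I ->
  (m + d' = n + e + e)%N ->
  exists (W : {vspace dhomog 3 k m}) (j : nat),
  [/\ forall p : dhomog 3 k m, p \in W <-> (p : R) \in I,
      ('C(n + 2, n) + \dim W + j = 3 * 'C(n + e + 2, n + e))%N,
      (\dim W <= 'C(m + 2, m))%N
    & (j <= 'C(n + e + d + 2, n + e + d) <= j + B)%N].
Proof.
have [B HB] := Syz_dim_bounds; exists B => I eps e d' n m heps eps0 epsS iso md.
have [S [j [SE dS jB]]] := HB (n + e)%N.
have [W [WE dW]] := bourbaki_dim hhom heps eps0 epsS iso md SE.
exists W, j; split=> //; first by rewrite dW.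
by rewrite -(dim_dhomog k) -dimvf dimvS ?subvf.
Qed.

Lemma bourbaki_codim_bounded (I : {pred R}) eps e :
  vhomog e eps -> eps != 0 -> eps \in Syz f -> cokernel_iso (Syz f) eps e d I ->
  exists B, forall n m, (m + d = n + e + e)%N ->
    exists W : {vspace dhomog 3 k m},
      (forall p : dhomog 3 k m, p \in W <-> (p : R) \in I) /\
      ('C(m + 2, m) <= \dim W + B)%N.
Proof.
move=> heps eps0 epsS iso; have [B HB] := bourbaki_codim_bounds.
exists ((d + e) * (d + e))%N => n m md.
have [W [j [WE dW _ /andP[jle _]]]] := HB I eps e d n m heps eps0 epsS iso md.
exists W; split=> //.
exact: codim_bound_arith (double_bin2 _) (double_bin2 _) (double_bin2 _) (double_bin2 _)
  md dW jle.
Qed.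

Lemma bourbaki_shift (I : {pred R}) eps e d' :
  vhomog e eps -> eps != 0 -> eps \in Syz f -> cokernel_iso (Syz f) eps e d' I ->
  (forall m, exists W : {vspace dhomog 3 k m},
      (forall p : dhomog 3 k m, p \in W <-> (p : R) \in I) /\
      (\dim W + 1)%N = 'C(m + 2, m)) -> d' = d.
Proof.
move=> heps eps0 epsS iso Icodim; have [B HB] := bourbaki_codim_bounds.
pose n := (2 * (B + (d + d' + e + 2) * (d + d' + e + 2)))%N.
pose m := (n + e + e - d')%N.
have md : (m + d' = n + e + e)%N.
  by rewrite /m subnK // /n; have := leq_addl (d + e) d'; lia.
have [W [j [WE dW _ jB]]] := HB I eps e d' n m heps eps0 epsS iso md.
have [W' [W'E dW']] := Icodim m.
have EW : W' = W by apply: vspace_ext => p; rewrite WE W'E.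
rewrite {}EW in dW'.
exact: shift_arith (double_bin2 _) (double_bin2 _) (double_bin2 _) (double_bin2 _)
  md dW jB dW' (leqnn _).
Qed.

End HilbertFunctions.

(** * The ideal of a point of the plane *)

Section LinearSubstitution.
Variables (n : nat) (K : fieldType).
Local Notation R := {mpoly K[n]}.

Lemma comp_mpoly_homog (lq : n.-tuple R) N (p : R) :
  (forall j, tnth lq j \is 1.-homog) -> p \is N.-homog -> p \mPo lq \is N.-homog.
Proof.
move=> hl hp; rewrite comp_mpolyEX big_seq rpred_sum // => m /(dhomog_mf hp) <-.
rewrite rpredZ // comp_mpolyX /= mdegE.
apply: (big_ind2 (fun (q : R) N => q \is N.-homog)) => [|q1 N1 q2 N2|j _].
- exact: dhomog1.
- exact: dhomogM.
- by rewrite -[X in X.-homog]mul1n; exact: dhomogMn.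
Qed.

Lemma pihomog_comp_mpoly (lq : n.-tuple R) N (p : R) :
  (forall j, tnth lq j \is 1.-homog) ->
  pihomog mdeg N (p \mPo lq) = (pihomog mdeg N p) \mPo lq.
Proof.
move=> hl; elim/mpoly_linear_ind: p => [m|c p q Ep Eq]; last first.
  by rewrite !linearP /= Ep Eq.
have h : 'X_[m] \mPo lq \is (mdeg m).-homog by rewrite comp_mpoly_homog // dhomogX.
rewrite pihomogX; case: eqVneq => [<-|ne]; first exact: pihomog_dE.
by rewrite comp_mpoly0; exact: pihomog_ne0 h.
Qed.

Definition linear_form (a : 'I_n -> K) : R := \sum_j a j *: 'X_j.

Lemma linear_form_homog a : linear_form a \is 1.-homog.
Proof. by apply: rpred_sum => j _; rewrite rpredZ // dhomogX /= mdeg1. Qed.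

Lemma mcoeff_linear_form a i : (linear_form a)@_U_(i) = a i.
Proof.
rewrite raddf_sum /= (bigD1 i) //= mcoeffZ mcoeffX eqxx mulr1 big1 ?addr0 // => j ji.
by rewrite mcoeffZ mcoeffX eq_mnm1 (negbTE ji) mulr0.
Qed.

Lemma linear_formP (p : R) : p \is 1.-homog -> p = linear_form (fun i => p@_U_(i)).
Proof.
move=> hp; apply/mpolyP => m; case: (boolP (mdeg m == 1%N)) => [/mdeg1P[i /eqP->]|md].
  by rewrite mcoeff_linear_form.
by rewrite (dhomog_nemf_coeff hp) // (dhomog_nemf_coeff (linear_form_homog _)).
Qed.

Lemma linear_form_eq0 a : linear_form a = 0 -> forall i, a i = 0.
Proof. by move=> a0 i; rewrite -mcoeff_linear_form a0 mcoeff0. Qed.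

(** This solves [linear_form a] = 0 for X_i when a_i is nonzero. The kernel of the substitution is
    the principal ideal of the form, which is thereby prime. *)
Definition elim_subst (a : 'I_n -> K) (i : 'I_n) : n.-tuple R :=
  [tuple if j == i then 'X_i - (a i)^-1 *: linear_form a else 'X_j | j < n].

Lemma elim_subst_form a i b : a i != 0 ->
  linear_form b \mPo elim_subst a i = linear_form b - (b i / a i) *: linear_form a.
Proof.
move=> ai; have E j : 'X_j \mPo elim_subst a i = 'X_j - ((j == i)%:R / a i) *: linear_form a.
  rewrite comp_mpolyXU -tnth_nth tnth_mktuple; case: eqVneq => [->|_].
    by rewrite mul1r.
  by rewrite mul0r scale0r subr0.
rewrite {1}/linear_form raddf_sum /=.
under eq_bigr do rewrite linearZ /= E scalerBr scalerA mulrA.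
rewrite big_split /= sumrN -scaler_suml; congr (_ - _ *: _).
rewrite (bigD1 i) //= eqxx mulr1 big1 ?addr0 // => j /negbTE->.
by rewrite mulr0 mul0r.
Qed.

Lemma linear_form_dvd a i (p : R) : a i != 0 ->
  p \mPo elim_subst a i = 0 <-> exists q, p = q * linear_form a.
Proof.
move=> ai; split=> [p0|[q ->]]; last first.
  by rewrite rmorphM /= (elim_subst_form _ ai) divff // scale1r subrr mulr0.
have [q] := comp_mpoly_sub (elim_subst a i) p; rewrite p0 subr0 => E.
exists ((a i)^-1 *: q i); rewrite {}E (bigD1 i) //= big1 => [|j ji].
  by rewrite addr0 tnth_mktuple eqxx subKr -scalerAl -scalerAr.
by rewrite tnth_mktuple (negbTE ji) subrr mulr0.
Qed.

Lemma linear_form_prime a i (p q r : R) : a i != 0 ->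
  p * q = r * linear_form a ->
  (exists s, p = s * linear_form a) \/ (exists s, q = s * linear_form a).
Proof.
move=> ai E; have : (p * q) \mPo elim_subst a i = 0 by apply/(linear_form_dvd _ ai); exists r.
rewrite rmorphM /= => /eqP; rewrite mulf_eq0 => /orP[] /eqP /(linear_form_dvd _ ai);
 by [left|right].
Qed.

Lemma linear_form_syzygy a b i (p q : R) : a i != 0 ->
  linear_form b <> (b i / a i) *: linear_form a ->
  p * linear_form b = q * linear_form a ->
  exists h, p = h * linear_form a /\ q = h * linear_form b.
Proof.
move=> ai ind E; have [[h Eh]|[s Es]] := linear_form_prime ai E.
  exists h; split=> //; apply: (@mulIf _ (linear_form a)).
    by apply/eqP => /linear_form_eq0/(_ i)/eqP; rewrite (negbTE ai).
  by rewrite -E Eh; ring.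
case: ind; apply/eqP; rewrite -subr_eq0 -(elim_subst_form _ ai); apply/eqP.
by apply/(linear_form_dvd _ ai); exists s.
Qed.

End LinearSubstitution.

(** * Linear independence modulo primes and the height of a point ideal *)

Section IndependentFamilies.
Variables (n : nat) (K : fieldType).
Local Notation R := {mpoly K[n]}.

Definition independent_mod (Q : {pred R}) (T : finType) (q : T -> R) :=
  forall a : T -> K, \sum_t a t *: q t \in Q -> forall t, a t = 0.

Lemma card_bmultinom_le N : (#|{: 'X_{1..n < N}}| <= N ^ n)%N.
Proof.
case: N => [|N]; first by rewrite eq_card0 // => m; have := bmdeg m.
pose g (m : 'X_{1..n < N.+1}) : {ffun 'I_n -> 'I_N.+1} := [ffun j => inord (m j)].
have gi : injective g.
  move=> m1 m2 /ffunP E; apply: val_inj; apply/mnmP => j.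
  have lt (m : 'X_{1..n < N.+1}) : (m j < N.+1)%N.
    by apply: leq_ltn_trans (bmdeg m); rewrite mdegE (bigD1 j) //= leq_addr.
  by have := congr1 val (E j); rewrite !ffunE /= !inordK.
by have := leq_card g gi; rewrite card_ffun !card_ord.
Qed.

Lemma too_many_dependent (T : finType) (q : T -> R) N :
  (forall t, msize (q t) <= N)%N -> (N ^ n < #|T|)%N ->
  exists a : T -> K, (exists t, a t != 0) /\ \sum_t a t *: q t = 0.
Proof.
move=> qN ltT; pose B := {: 'X_{1..n < N}}.
pose M := \matrix_(s < #|T|, j < #|B|) (q (enum_val s))@_(enum_val j : 'X_{1..n < N}).
have : kermx M != 0.
  rewrite -mxrank_eq0 mxrank_ker -lt0n subn_gt0.
  by rewrite (leq_ltn_trans (rank_leq_col _)) // (leq_ltn_trans (card_bmultinom_le _)).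
case/rowV0Pn=> v /sub_kermxP vM v0.
exists (fun t => v 0 (enum_rank t)); split.
  have [s vs] := rV_neq0 v0.
  by exists (enum_val s); rewrite enum_valK.
apply/mpolyP => m; rewrite mcoeff0 raddf_sum /=.
case: (ltnP (mdeg m) N) => mN; last first.
  rewrite big1 // => t _; rewrite mcoeffZ memN_msupp_eq0 ?mulr0 //.
  by rewrite msize_mdeg_ge // (leq_trans (qN t)).
have /rowP/(_ (enum_rank (BMultinom mN : B))) := vM.
rewrite !mxE (reindex (@enum_rank T)) /=; last by apply: onW_bij; exact: enum_rank_bij.
by move=> E; rewrite -[RHS]E; apply: eq_bigr => t _; rewrite mcoeffZ mxE !enum_rankK.
Qed.

End IndependentFamilies.

Section PrimeChains.
Variable K : fieldType.
Local Notation R := {mpoly K[3]}.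

(** Modulo Q only the terms with exponent 0 of b survive, so their coefficients vanish. The rest is
    divisible by b, which can be cancelled modulo the prime P, and one repeats. Each strict
    inclusion of primes thus contributes one more algebraically independent element. *)
Lemma independent_mod_expand (P Q : {pred R}) b (T : finType) (q : T -> R) :
  prime_ideal P -> prime_ideal Q -> {subset P <= Q} -> b \in Q -> b \notin P ->
  independent_mod Q q -> forall m, independent_mod P (fun st : 'I_m * T => b ^+ st.1 * q st.2).
Proof.
move=> [[P0 P1 PD] PM] [[Q0 Q1 QD] QM] PQ bQ bP qQ.
have main m (a : nat -> T -> K) :
    \sum_(s < m) b ^+ s * (\sum_t a s t *: q t) \in P ->
    forall s, (s < m)%N -> forall t, a s t = 0.
  elim: m a => [|m IH] a //; rewrite big_ord_recl expr0 mul1r.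
  set A0 := \sum_t _; set S := \sum_(s < m) _ => inP.
  have ES : S = b * \sum_(s < m) b ^+ s * (\sum_t a s.+1 t *: q t).
    rewrite mulr_sumr; apply: eq_bigr => s _; rewrite mulrA -exprS.
    by rewrite /bump /=.
  have a0 : forall t, a 0%N t = 0.
    apply: qQ; rewrite -/A0.
    have -> : A0 = (- \sum_(s < m) b ^+ s * (\sum_t a s.+1 t *: q t)) * b + (A0 + S).
      by rewrite ES; ring.
    by apply: QD => //; exact: PQ.
  have A00 : A0 = 0 by rewrite /A0 big1 // => t _; rewrite a0 scale0r.
  move: inP; rewrite A00 add0r ES => /PM; rewrite (negbTE bP) /= => inP.
  by case=> [|s] // sm; exact: (IH (fun s => a s.+1)).
move=> m a H [s t].
have {}H : \sum_s \sum_t a (s, t) *: (b ^+ s * q t) \in P.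
  by rewrite pair_bigA /=; move: H; congr (_ \in P); apply: eq_bigr => -[].
pose a' (s : nat) t := if insub s is Some s' then a (s', t) else 0.
have Ea s' t' : a' (val s') t' = a (s', t') by rewrite /a' valK.
rewrite -Ea; apply: (main m a' _ s) => //.
move: H; congr (_ \in P).
apply: eq_bigr => s' _; rewrite mulr_sumr; apply: eq_bigr => t' _.
by rewrite Ea scalerAr.
Qed.

End PrimeChains.

Section PointIdeal.
Variables (K : fieldType).
Local Notation R := {mpoly K[3]}.

Definition subst_ker (lq : 3.-tuple R) : {pred R} := [pred p : R | p \mPo lq == 0].

Lemma subst_ker_idealr lq : idealr_closed (subst_ker lq).
Proof.
split; rewrite ?inE; first by rewrite comp_mpoly0.
  by rewrite comp_mpoly1 oner_eq0.
move=> a p q; rewrite !inE => /eqP p0 /eqP q0.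
by rewrite comp_mpolyD rmorphM /= p0 q0 mulr0 addr0.
Qed.

Lemma subst_ker_prime lq : prime_ideal (subst_ker lq).
Proof.
split; first exact: subst_ker_idealr.
by move=> p q; rewrite !inE rmorphM /= mulf_eq0.
Qed.

Variables (i : 'I_3) (c : 'I_3 -> K).
Hypothesis ci : c i = 1.

Definition point_subst : 3.-tuple R := [tuple c j *: 'X_i | j < 3].

(* The ideal of the point c of the projective plane, as the kernel of the     *)
(* restriction X_j |-> c_j X_i to the affine line k c (recall c_i = 1).      *)
Definition point_ideal : {pred R} := subst_ker point_subst.

Definition point_line (j : 'I_3) : R := 'X_j - c j *: 'X_i.

Lemma point_subst_homog j : tnth point_subst j \is 1.-homog.
Proof. by rewrite tnth_mktuple rpredZ // dhomogX /= mdeg1. Qed.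

Lemma point_subst_form N (p : R) : p \is N.-homog ->
  p \mPo point_subst = p.@[c] *: 'X_i ^+ N.
Proof.
move=> hp; rewrite comp_mpolyEX mevalE scaler_suml big_seq [RHS]big_seq.
apply: eq_bigr => m /(dhomog_mf hp) <-; rewrite comp_mpolyX /= -scalerA; congr (_ *: _).
under eq_bigr do rewrite tnth_mktuple exprZn.
by rewrite scaler_prod; congr (_ *: _); rewrite prodrXr mdegE.
Qed.

Lemma point_ideal_form N (p : R) : p \is N.-homog -> (p \in point_ideal) = (p.@[c] == 0).
Proof.
move=> hp; rewrite inE (point_subst_form hp) -mul_mpolyC mulf_eq0 mpolyC_eq0.
by rewrite [_ ^+ _ == 0]expf_eq0 -msize_poly_eq0 msizeX andbF orbF.
Qed.

Lemma point_ideal_homogeneous : homogeneous_ideal point_ideal.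
Proof.
move=> p n; rewrite !inE -(pihomog_comp_mpoly _ _ point_subst_homog) => /eqP->.
by rewrite raddf0.
Qed.

Lemma point_line_mem j : point_line j \in point_ideal.
Proof.
rewrite inE /point_line comp_mpolyB comp_mpolyZ !comp_mpolyXU -!tnth_nth !tnth_mktuple.
by rewrite ci scale1r subrr.
Qed.

Lemma point_ideal_lines (p : R) : p \in point_ideal ->
  exists q : 'I_3 -> R, p = \sum_j q j * point_line j.
Proof.
rewrite inE => /eqP p0; have [q E] := comp_mpoly_sub point_subst p.
exists q; move: E; rewrite p0 subr0 => ->; apply: eq_bigr => j _.
by rewrite tnth_mktuple.
Qed.

Definition line_coef (j l : 'I_3) : K := (l == j)%:R - c j * (l == i)%:R.

Lemma point_lineE j : point_line j = linear_form (line_coef j).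
Proof.
rewrite /linear_form /line_coef.
under eq_bigr do rewrite scalerBl -scalerA.
have D l : \sum_(j0 < 3) (j0 == l)%:R *: 'X_j0 = 'X_l :> R.
  rewrite (bigD1 l) //= eqxx scale1r big1 ?addr0 // => l' /negbTE->.
  by rewrite scale0r.
by rewrite sumrB -scaler_sumr !D.
Qed.

Lemma line_coef_diag j : j != i -> line_coef j j = 1.
Proof. by move=> /negbTE ji; rewrite /line_coef eqxx ji mulr0 subr0. Qed.

Lemma line_coef_off j l : j != l -> j != i -> line_coef l j = 0.
Proof. by move=> /negbTE jl /negbTE ji; rewrite /line_coef jl ji mulr0 subr0. Qed.

Lemma point_ideal_dim m : exists W : {vspace dhomog 3 K m},
  (forall p : dhomog 3 K m, p \in W <-> (p : R) \in point_ideal) /\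
  (\dim W + 1)%N = 'C(m + 2, m).
Proof.
pose F (p : dhomog 3 K m) : K^o := (p : R).@[c].
have Flin : linear F by move=> a p q; rewrite /F !linearP.
have [N [W [NE WE dNW]]] := rank_nullity Flin.
exists N; split=> [p|].
  rewrite NE (point_ideal_form (dhomog_is_dhomog p)).
  by split=> /eqP.
rewrite -[RHS]dNW; congr (_ + _)%N; have -> : W = fullv.
  apply: vspace_ext => w; rewrite memvf WE; split=> // _.
  have hX : w *: 'X_[U_(i) *+ m] \is m.-homog.
    by rewrite rpredZ // dhomogX /= mdegMn mdeg1 mul1n.
  by exists (DHomog hX); rewrite /F /= mevalZ -mpolyXn rmorphXn /= mevalXU ci expr1n mulr1.
by rewrite dimvf.
Qed.


Lemma point_ideal_height_ge (P : {pred R}) :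
  prime_ideal P -> {subset point_ideal <= P} -> height_ge P 2.
Proof.
move=> Pprime IP; pose j1 := lift i (ord0 : 'I_2); pose j2 := lift i (ord_max : 'I_2).
have [j1i j2i] : j1 != i /\ j2 != i by rewrite /j1 /j2 ![_ == i]eq_sym !neq_lift.
have j12 : j1 != j2 by rewrite (inj_eq lift_inj).
have l1 : line_coef j1 j1 != 0 by rewrite line_coef_diag // oner_eq0.
(* The chain is 0, (l_1), P. The first two are kernels of substitutions, the identity and the
   elimination of X_j1, hence prime. *)
pose ch (e : nat) : {pred R} := match e with
  | 0 => subst_ker [tuple 'X_l | l < 3]
  | 1 => subst_ker (elim_subst (line_coef j1) j1)
  | _ => P end.
exists ch; split=> //.
- by case=> [|[|[|]]] // _; exact: subst_ker_prime.
case=> [|[|//]] _; split.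
- by move=> p; rewrite !inE comp_mpoly_id => /eqP->; rewrite comp_mpoly0.
- exists (linear_form (line_coef j1)); rewrite inE.
    by apply/eqP/(linear_form_dvd _ l1); exists 1; rewrite mul1r.
  rewrite comp_mpoly_id; apply: contraNneq l1 => /linear_form_eq0/(_ j1) ->.
  exact: eqxx.
- move=> p; rewrite inE => /eqP/(linear_form_dvd _ l1)[q ->].
  have [[_ _ PD] _] := Pprime.
  have [[P0 _ _] _] := Pprime.
  by rewrite -[_ * _]addr0; apply: PD => //; apply: IP; rewrite -point_lineE point_line_mem.
- exists (point_line j2); first by apply: IP; exact: point_line_mem.
  rewrite inE point_lineE (elim_subst_form _ l1) line_coef_off // mul0r scale0r subr0.
  apply/eqP => /linear_form_eq0/(_ j2)/eqP.
  by rewrite line_coef_diag // oner_eq0.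
Qed.

Lemma msizeX_exp_le (p : R) D m : (msize p <= D)%N -> (msize (p ^+ m) <= (D * m).+1)%N.
Proof.
move=> pD; elim: m => [|m IH]; first by rewrite expr0 msize1 muln0.
case: (eqVneq p 0) => [->|p0]; first by rewrite exprS mul0r msize0.
rewrite exprS msizeM ?expf_neq0 // mulnS.
by rewrite (leq_trans (leq_pred _)) // -addnS leq_add.
Qed.

(* A chain of primes of length 3 ending here would make b_0, b_1, b_2 and X_i  *)
(* algebraically independent, where b_e lies in ch e.+1 but not in ch e.       *)
Lemma point_ideal_not_height_ge (P : {pred R}) : P =i point_ideal -> ~ height_ge P 3.
Proof.
move=> PI [ch [chprime chlt chP]].
have [_ [b0 b0Q b0P]] := chlt 0%N isT; have [_ [b1 b1Q b1P]] := chlt 1%N isT.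
have [_ [b2 b2Q b2P]] := chlt 2%N isT.
(* The m^4 products of powers with exponents below m have size at most (3D + 1) m. As m exceeds (3D
   + 1)^3, their number exceeds ((3D + 1) m)^3, so they are linearly dependent. *)
pose D := (msize b0 + msize b1 + msize b2 + 2)%N; pose m := ((3 * D + 1) ^ 3).+1.
have ind3 : independent_mod (ch 3) (fun s : 'I_m => ('X_i : R) ^+ s).
  move=> a; rewrite chP PI inE raddf_sum /=.
  under eq_bigr do rewrite linearZ /= rmorphXn /= comp_mpolyXU -tnth_nth tnth_mktuple ci scale1r.
  move=> /eqP E s; have /mpolyP/(_ (U_(i) *+ s)%MM) := E.
  rewrite mcoeff0 raddf_sum /= (bigD1 s) //= mcoeffZ mcoeffXn eqxx mulr1 big1 ?addr0 //.
  move=> s' ne; rewrite mcoeffZ mcoeffXn; case: eqP => [/mnmP/(_ i)|_]; last by rewrite mulr0.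
  by rewrite !mulmnE mnm1E eqxx !mul1n => /val_inj E'; rewrite E' eqxx in ne.
have ind2 := independent_mod_expand (m := m) (chprime 2 isT) (chprime 3 isT)
  (chlt 2 isT).1 b2Q b2P ind3.
have ind1 := independent_mod_expand (m := m) (chprime 1 isT) (chprime 2 isT)
  (chlt 1 isT).1 b1Q b1P ind2.
have ind0 := independent_mod_expand (m := m) (chprime 0 isT) (chprime 1 isT)
  (chlt 0 isT).1 b0Q b0P ind1.
have [||a [[t at0] E]] := too_many_dependent (q := fun st : 'I_m * ('I_m * ('I_m * 'I_m)) =>
    b0 ^+ st.1 * (b1 ^+ st.2.1 * (b2 ^+ st.2.2.1 * ('X_i : R) ^+ st.2.2.2))) (N := (3 * D + 1) * m).
- move=> [s0 [s1 [s2 s3]]] /=.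
  have le_m (s : 'I_m) : (s <= m.-1)%N by rewrite -ltnS prednK // ltn_ord.
  have big (b p : R) (s : 'I_m) M : (msize b <= D)%N -> (msize p <= M)%N ->
      (msize (b ^+ s * p) <= D * m + M)%N.
    move=> bD pM; case: (eqVneq (b ^+ s * p) 0) => [->|]; first by rewrite msize0.
    rewrite mulf_eq0 negb_or => /andP[bs0 p0]; rewrite msizeM //.
    have := msizeX_exp_le s bD; have : (D * s <= D * m)%N by rewrite leq_mul2l ltnW ?orbT.
    move: (msize (b ^+ s)) (msize p) pM => x y; lia.
  have -> : ((3 * D + 1) * m = D * m + (D * m + (D * m + m)))%N by ring.
  have D0 : (msize b0 <= D)%N by rewrite /D; lia.
  have D1 : (msize b1 <= D)%N by rewrite /D; lia.
  have D2 : (msize b2 <= D)%N by rewrite /D; lia.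
  have DX : (msize (('X_i : R) ^+ s3) <= m)%N by rewrite mpolyXn msizeX mdegMn mdeg1 mul1n.
  by rewrite !big.
- rewrite !card_prod !card_ord expnMn /m; set M := ((3 * D + 1) ^ 3)%N.
  apply: (@leq_trans (M.+1 * (M.+1 ^ 3))%N); last by rewrite !expnS expn0 muln1.
  by rewrite ltn_mul2r expn_gt0 /= ltnSn.
have [[P0 _ _] _] := chprime 0%N isT.
by have := ind0 a; rewrite E => /(_ P0 t)/eqP; rewrite (negbTE at0).
Qed.

Lemma point_ideal_codim : codim_ideal point_ideal 2.
Proof.
split; first exact: point_ideal_height_ge.
exists point_ideal; split=> //; first exact: subst_ker_prime.
exact: point_ideal_not_height_ge.
Qed.

End PointIdeal.

(** * Degree one implies nearly free *)

(** The product of the P - v for v at most B vanishes at all large integers, so one factor is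
    zero. *)
Lemma bounded_poly_const (P : {poly rat}) B N :
  (forall n, (N <= n)%N -> exists2 h, (h <= B)%N & P.[n%:R] = h%:R) ->
  exists v : nat, P = v%:R%:P.
Proof.
move=> HP; pose Q := \prod_(v < B.+1) (P - (v%:R)%:P).
have : Q == 0.
  apply/eqP; apply: (@roots_geq_poly_eq0 _ _ [seq n%:R | n <- iota N (size Q)]).
  - apply/allP => x /mapP[n]; rewrite mem_iota => /andP[/HP[h hB Ph] _] ->.
    rewrite rootE horner_prod (bigD1 (Ordinal (hB : (h < B.+1)%N))) //=.
    by rewrite hornerD hornerN hornerC Ph subrr mul0r.
  - rewrite map_inj_uniq ?iota_uniq // => x y E.
    by apply/eqP; rewrite -(eqr_nat rat); apply/eqP.
  - by rewrite size_map size_iota.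
by rewrite prodf_seq_eq0 => /hasP[v _ /=]; rewrite subr_eq0 => /eqP ->; exists v.
Qed.

Section QuotientDegree.
Variables (K : fieldType) (I : {pred {mpoly K[3]}}).

Lemma hilbert_function_inj n h h' :
  hilbert_function I n h -> hilbert_function I n h' -> h = h'.
Proof.
move=> [U UI ->] [V VI ->]; congr (_ - \dim _)%N.
by apply: vspace_ext => p; rewrite UI VI.
Qed.

(** A bounded Hilbert function makes the Hilbert polynomial a nonzero constant; the factorial is
    then 0! and the degree is this constant. *)
Lemma quotient_degree_bounded m B N : quotient_degree I m ->
  (forall n, (N <= n)%N -> exists2 h, (h <= B)%N & hilbert_function I n h) ->
  exists N', forall n, (N' <= n)%N -> hilbert_function I n m.
Proof.
move=> [H [P [HI [N1 HP] P0 mE]]] bdd.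
have HB n : (N + N1 <= n)%N -> exists2 h, (h <= B)%N & P.[n%:R] = h%:R.
  move=> nN; have [|h hB Ih] := bdd n; first by lia.
  by exists h; rewrite // -HP ?(hilbert_function_inj (HI n) Ih) //; lia.
have [v Ev] := bounded_poly_const HB.
exists N1 => n nN1; suff -> : m = H n by exact: HI.
apply/eqP; rewrite -(eqr_nat rat) mE HP // Ev hornerC size_polyC lead_coefC.
by move: P0; rewrite Ev polyC_eq0 => -> /=; rewrite mul1r.
Qed.

Lemma quotient_degree1 : (forall n, hilbert_function I n 1) -> quotient_degree I 1.
Proof.
move=> H1; exists (fun=> 1%N), 1; split=> //; last by rewrite size_poly1 lead_coef1 mulr1.
  by exists 0%N => n _; rewrite hornerC.
exact: oner_neq0.
Qed.

End QuotientDegree.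

Definition o0 : 'I_3 := @Ordinal 3 0 isT.
Definition o1 : 'I_3 := @Ordinal 3 1 isT.
Definition o2 : 'I_3 := @Ordinal 3 2 isT.

Lemma ord3_ind (P : 'I_3 -> Prop) : P o0 -> P o1 -> P o2 -> forall i, P i.
Proof.
move=> P0 P1 P2 [[|[|[|//]]] Hi].
- by rewrite (_ : Ordinal Hi = o0) //; apply: val_inj.
- by rewrite (_ : Ordinal Hi = o1) //; apply: val_inj.
- by rewrite (_ : Ordinal Hi = o2) //; apply: val_inj.
Qed.

Lemma ord3_third (i j1 j2 j : 'I_3) :
  j1 != i -> j2 != i -> j1 != j2 -> j != j1 -> j != j2 -> j = i.
Proof.
rewrite -!val_eqE /= => ? ? ? ? ?; apply: val_inj => /=.
have := ltn_ord i; have := ltn_ord j1; have := ltn_ord j2; have := ltn_ord j; lia.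
Qed.

Lemma big_ord3 (V : nmodType) (F : 'I_3 -> V) : \sum_(i < 3) F i = F o0 + F o1 + F o2.
Proof.
rewrite !big_ord_recl big_ord0 addr0 addrA.
by congr (F _ + F _ + F _); apply: val_inj.
Qed.

Definition row3 (A : nmodType) (a b c : A) : 'rV[A]_3 :=
  \row_(j < 3) tnth [tuple a; b; c] j.

Definition rows3 (A : nmodType) n (u v w : 'rV[A]_n) : 'M[A]_(3, n) :=
  \matrix_(r < 3, s < n) tnth [tuple u; v; w] r 0 s.

Lemma row3E0 (A : nmodType) (a b c : A) : row3 a b c 0 o0 = a. Proof. by rewrite mxE. Qed.
Lemma row3E1 (A : nmodType) (a b c : A) : row3 a b c 0 o1 = b. Proof. by rewrite mxE. Qed.
Lemma row3E2 (A : nmodType) (a b c : A) : row3 a b c 0 o2 = c. Proof. by rewrite mxE. Qed.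
Definition row3E := (row3E0, row3E1, row3E2).

Lemma rows3E0 (A : nmodType) n (u v w : 'rV[A]_n) s : rows3 u v w o0 s = u 0 s.
Proof. by rewrite mxE. Qed.
Lemma rows3E1 (A : nmodType) n (u v w : 'rV[A]_n) s : rows3 u v w o1 s = v 0 s.
Proof. by rewrite mxE. Qed.
Lemma rows3E2 (A : nmodType) n (u v w : 'rV[A]_n) s : rows3 u v w o2 s = w 0 s.
Proof. by rewrite mxE. Qed.
Definition rows3E := (rows3E0, rows3E1, rows3E2).

Lemma mulmx_rows3 (A : comNzRingType) n (c : 'rV[A]_3) (u v w : 'rV[A]_n) :
  c *m rows3 u v w = c 0 o0 *: u + c 0 o1 *: v + c 0 o2 *: w.
Proof. by apply/rowP => s; rewrite !mxE big_ord3 !rows3E. Qed.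

Lemma homog_succ_decomp n (K : fieldType) N (p : {mpoly K[n]}) : p \is N.+1.-homog ->
  exists q : 'I_n -> {mpoly K[n]}, (forall j, q j \is N.-homog) /\ p = \sum_j q j * 'X_j.
Proof.
move=> hp; pose lq : n.-tuple {mpoly K[n]} := [tuple 0 | j < n].
have [q E] := comp_mpoly_sub lq p.
exists (fun j => pihomog mdeg N (q j)); split=> [j|]; first exact: pihomogP.
have E0 : pihomog mdeg N.+1 (p \mPo lq) = 0.
  rewrite pihomog_comp_mpoly; last by move=> j; rewrite tnth_mktuple; exact: rpred0.
  rewrite (pihomog_dE hp) comp_mpolyEX big_seq big1 // => m /(dhomog_mf hp) /= mN.
  rewrite comp_mpolyX /=.
  have [j mj] : exists j, m j != 0%N.
    apply/existsP; rewrite -[X in is_true X]negbK; apply/negP; rewrite negb_exists => /forallP m0.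
    by move: mN; rewrite mdegE big1 // => j _; have /negPn/eqP := m0 j.
  by rewrite (bigD1 j) //= tnth_mktuple expr0n (negbTE mj) mul0r scaler0.
have /(congr1 (pihomog mdeg N.+1)) := E.
rewrite pihomogB E0 subr0 (pihomog_dE hp) => ->; rewrite raddf_sum /=.
apply: eq_bigr => j _; rewrite tnth_mktuple subr0.
have hX : ('X_j : {mpoly K[n]}) \is 1.-homog by rewrite dhomogX /= mdeg1.
by rewrite (pihomogMr _ _ hX) subn1.
Qed.

Lemma row_linear_syzygy (K : fieldType) (a b : 'I_3 -> K) i n (u v : 'rV[{mpoly K[3]}]_n) :
  a i != 0 -> linear_form b <> (b i / a i) *: linear_form a ->
  linear_form b *: u = linear_form a *: v ->
  exists w, u = linear_form a *: w.
Proof.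
move=> ai ind E.
have coord s : exists h, u 0 s = linear_form a * h.
  have /rowP/(_ s) := E; rewrite !mxE mulrC [RHS]mulrC.
  by case/(linear_form_syzygy ai ind) => h [-> _]; exists h; rewrite mulrC.
have [w wP] := fun_choice coord; exists (\row_s w s).
by apply/rowP => s; rewrite !mxE.
Qed.

Lemma linear_formX (K : fieldType) (j : 'I_3) :
  'X_j = linear_form (fun l => (l == j)%:R) :> {mpoly K[3]}.
Proof.
rewrite /linear_form (bigD1 j) //= eqxx scale1r big1 ?addr0 // => l /negbTE->.
exact: scale0r.
Qed.

Section CokernelIso.
Variables (k : closedFieldType) (d : nat) (f : {mpoly k[3]}).
Local Notation R := {mpoly k[3]}.
Local Notation S := (Syz f).
Hypothesis hhom : f \is d.+1.-homog.
Variables (I : {pred R}) (eps : 'rV[R]_3) (e : nat) (phi : 'rV[R]_3 -> R).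
Hypothesis epsS : eps \in S.
Hypothesis eps0 : eps != 0.
Hypothesis phiD : forall a u v, u \in S -> v \in S -> phi (a *: u + v) = a * phi u + phi v.
Hypothesis phiK : forall v, v \in S -> (phi v = 0 <-> exists a, v = a *: eps).
Hypothesis phiI : forall p, p \in I <-> exists2 v, v \in S & phi v = p.

Lemma cokernel_map0 : phi 0 = 0.
Proof. by have := phiD (-1) (Syz0 f) (Syz0 f); rewrite scaler0 addr0 mulN1r addNr. Qed.

Lemma cokernel_mapZ a u : u \in S -> phi (a *: u) = a * phi u.
Proof. by move=> uS; rewrite -[_ *: _]addr0 phiD ?Syz0 // cokernel_map0 addr0. Qed.

Lemma SyzB u v : u \in S -> v \in S -> u - v \in S.
Proof. by move=> uS vS; rewrite addrC -scaleN1r; apply: SyzD. Qed.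

Lemma cokernel_mapB u v : u \in S -> v \in S -> phi (u - v) = phi u - phi v.
Proof.
move=> uS vS; have -> : u - v = (-1) *: v + u by rewrite scaleN1r addrC.
by rewrite phiD // mulN1r addrC.
Qed.

Lemma cokernel_mapD u v : u \in S -> v \in S -> phi (u + v) = phi u + phi v.
Proof. by move=> uS vS; rewrite -{1}[u]scale1r phiD // mul1r. Qed.

Lemma kernel_scale_inj a b : a *: eps = b *: eps -> a = b.
Proof.
move=> E; have [i ei] := rV_neq0 eps0.
by move/rowP/(_ i): E; rewrite !mxE => /(mulIf ei).
Qed.

(* Depth of R/I is positive: writing X_j p = phi(s_j), the Koszul relations  *)
(* among the s_j hold modulo R eps, and exactness of the Koszul complex lets *)
(* one correct the s_j so that s_0 becomes divisible by X_0 in S.            *)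
Lemma image_saturated p : (forall j, 'X_j * p \in I) -> p \in I.
Proof.
move=> pI; have [s0 s0S E0] := (phiI _).1 (pI o0); have [s1 s1S E1] := (phiI _).1 (pI o1).
have [s2 s2S E2] := (phiI _).1 (pI o2).
have rel a b u v : u \in S -> v \in S -> phi u = 'X_a * p -> phi v = 'X_b * p ->
    exists h : R, 'X_b *: u - 'X_a *: v = h *: eps.
  move=> uS vS Eu Ev; apply/phiK; first by apply: SyzB; exact: SyzZ.
  by rewrite cokernel_mapB ?SyzZ // !cokernel_mapZ // Eu Ev; ring.
have [h Eh] := rel _ _ _ _ s0S s1S E0 E1; have [h' Eh'] := rel _ _ _ _ s0S s2S E0 E2.
have [h'' Eh''] := rel _ _ _ _ s1S s2S E1 E2.
have koszul : 'X_o2 * h = 'X_o1 * h' - 'X_o0 * h''.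
  apply: kernel_scale_inj; rewrite scalerBl -!scalerA -Eh -Eh' -Eh''.
  by apply/rowP => j; rewrite !mxE; ring.
(* Setting X_0 = X_1 = 0 in the Koszul relation kills h, so h = q_0 X_0 + q_1 X_1; the q_j are the
   corrections to s_0 and s_1. *)
pose lq : 3.-tuple R := [tuple 0; 0; 'X_o2].
have lqh : h \mPo lq = 0.
  have X0 : 'X_o0 \mPo lq = 0 by rewrite comp_mpolyXU.
  have X1 : 'X_o1 \mPo lq = 0 by rewrite comp_mpolyXU.
  have X2 : 'X_o2 \mPo lq = 'X_o2 by rewrite comp_mpolyXU.
  have := congr1 (comp_mpoly lq) koszul.
  rewrite rmorphB !rmorphM /= X0 X1 X2 !mul0r subr0 => /eqP.
  by rewrite mulf_eq0 -msize_poly_eq0 msizeX /= => /eqP.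
have [q Eq] := comp_mpoly_sub lq h.
rewrite lqh subr0 big_ord3 /= !subr0 (_ : tnth lq o2 = 'X_o2) // subrr mulr0 addr0 in Eq.
pose u := s0 - q o1 *: eps; pose v := s1 + q o0 *: eps.
have uv : 'X_o1 *: u = 'X_o0 *: v.
  apply/eqP; rewrite -subr_eq0; apply/eqP.
  transitivity ('X_o1 *: s0 - 'X_o0 *: s1 - h *: eps); last by rewrite Eh subrr.
  by rewrite Eq; apply/rowP => j; rewrite !mxE; ring.
have [w Ew] : exists w, u = 'X_o0 *: w.
  move: uv; rewrite !linear_formX => uv.
  apply: (row_linear_syzygy (i := o0) _ _ uv); rewrite /= ?oner_eq0 //.
  rewrite mul0r scale0r => /linear_form_eq0/(_ o1)/eqP; by rewrite eqxx oner_eq0.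
have X0 : ('X_o0 : R) != 0 by rewrite -msize_poly_eq0 msizeX.
have uS : u \in S by apply: SyzB => //; exact: SyzZ.
have wS : w \in S by apply: (Syz_saturated X0); rewrite -Ew.
apply/phiI; exists w => //; apply: (mulfI X0).
rewrite -cokernel_mapZ // -Ew cokernel_mapB ?SyzZ // E0 (phiK _).2 ?subr0 ?SyzZ //.
by exists (q o1).
Qed.

Lemma image_saturated_homog N p :
  (forall q : R, q \is N.-homog -> q * p \in I) -> p \in I.
Proof.
elim: N => [|N IH] pI; first by rewrite -[p]mul1r; apply: pI; exact: dhomog1.
apply: IH => q hq; apply: image_saturated => j; rewrite mulrA; apply: pI.
by rewrite -[N.+1]add1n; apply: dhomogM => //; rewrite dhomogX /= mdeg1.
Qed.

End CokernelIso.

(** * Saturated ideals with Hilbert function eventually 1 *)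

Section DegreeOneIdeals.
Variables (K : fieldType) (I : {pred {mpoly K[3]}}).
Local Notation R := {mpoly K[3]}.

Lemma hilbert_function1 n : hilbert_function I n 1 ->
  exists u : R, [/\ u \is n.-homog, u \notin I &
    forall p : R, p \is n.-homog -> exists a, p - a *: u \in I].
Proof.
move=> [U UI dU].
have /subvPn[u _ uU] : ~~ (fullv <= U)%VS.
  apply/negP => /dimvS le; move/eqP: le; lia.
have full : (U + <[u]>)%VS = fullv.
  apply/eqP; rewrite eqEdim subvf /=.
  have : (\dim U < \dim (U + <[u]>))%N.
    rewrite ltn_neqAle (dimv_leqif_sup (addvSl U _)).1 andbT.
    rewrite (dimv_leqif_sup (addvSl U _)).2; apply: contra uU => /subvP; apply.
    by rewrite (subvP (addvSr U _)) // memv_line.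
  lia.
exists u; split; [exact: dhomog_is_dhomog | by rewrite -UI|] => p hp.
have : DHomog hp \in (U + <[u]>)%VS by rewrite full memvf.
case/memv_addP=> w wU [_ /vlineP[a ->]] E; exists a.
have -> : p - a *: (u : R) = w by rewrite -[p]/(mpoly_of_dhomog (DHomog hp)) E /= addrK.
by rewrite -UI.
Qed.

Hypothesis I_ideal : idealr_closed I.
Hypothesis I_homog : homogeneous_ideal I.
Hypothesis I_sat : forall N p, (forall q : R, q \is N.-homog -> q * p \in I) -> p \in I.

Let I0 : 0 \in I. Proof. by case: I_ideal. Qed.
Let ID p q : p \in I -> q \in I -> p + q \in I.
Proof. by case: I_ideal => _ _ H pI qI; rewrite -[p]mul1r; apply: H. Qed.
Let IM p q : q \in I -> p * q \in I.
Proof. by case: I_ideal => _ _ H qI; rewrite -[_ * _]addr0; apply: H. Qed.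
Let IZ a p : p \in I -> a *: p \in I.
Proof. by rewrite -mul_mpolyC; exact: IM. Qed.
Let IB p q : p \in I -> q \in I -> p - q \in I.
Proof. by move=> pI qI; rewrite -mulN1r; apply: ID => //; exact: IM. Qed.
Let Isum (F : 'I_3 -> R) : (forall j, F j \in I) -> \sum_j F j \in I.
Proof. by move=> FI; apply: (big_ind (fun p => p \in I)). Qed.

(** Let u and w span R/I in degrees N and N + 1. Then X_j u = lam_j w modulo I, and lam is the point
    sought; it is nonzero since otherwise w would lie in I. The line X_j - c_j X_i kills u, hence
    all of (R/I)_N, and so lies in I by saturation. *)
Lemma point_lines_in_ideal N : (forall n, (N <= n)%N -> hilbert_function I n 1) ->
  exists (i : 'I_3) (c : 'I_3 -> K), c i = 1 /\ forall j, point_line i c j \in I.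
Proof.
move=> H1; have [u [hu uI uP]] := hilbert_function1 (H1 N (leqnn N)).
have [w [hw wI wP]] := hilbert_function1 (H1 N.+1 (leqnSn N)).
have hX (j : 'I_3) (q : R) : q \is N.-homog -> 'X_j * q \is N.+1.-homog.
  by move=> hq; rewrite -[N.+1]add1n; apply: dhomogM => //; rewrite dhomogX /= mdeg1.
have [lam lamP] := fun_choice (fun j => wP _ (hX j u hu)).
have [i lami] : exists i, lam i != 0.
  apply/existsP; apply: contraNT wI; rewrite negb_exists => /forallP lam0.
  have [q [hq ->]] := homog_succ_decomp hw; apply: Isum => j.
  have Xu : 'X_j * u \in I.
    by have := lamP j; have /negPn/eqP -> := lam0 j; rewrite scale0r subr0.
  have [a qa] := uP _ (hq j).
  have -> : q j * 'X_j = 'X_j * (q j - a *: u) + a%:MP * ('X_j * u).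
    by rewrite -mul_mpolyC; ring.
  by apply: ID; exact: IM.
exists i, (fun j => lam j / lam i); split=> [|j]; first by rewrite divff.
apply: (@I_sat N) => q hq; have [a qa] := uP _ hq.
have -> : q * point_line i (fun j => lam j / lam i) j =
    point_line i (fun j => lam j / lam i) j * (q - a *: u) +
    a%:MP * (('X_j * u - lam j *: w) - (lam j / lam i)%:MP * ('X_i * u - lam i *: w)).
  have Elam : lam j *: w = (lam j / lam i)%:MP * (lam i *: w).
    by rewrite mul_mpolyC scalerA divfK.
  by rewrite Elam /point_line -!mul_mpolyC; ring.
by apply: ID; apply: IM => //; apply: IB => //; exact: IM.
Qed.

(** I contains the point ideal. A form of I not vanishing at the point would put a power of X_i into
    I, hence all forms of large degree, against the Hilbert function being 1. *)
Lemma degree1_ideal_point N : (forall n, (N <= n)%N -> hilbert_function I n 1) ->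
  exists (i : 'I_3) (c : 'I_3 -> K), c i = 1 /\ I =i point_ideal i c.
Proof.
move=> H1; have [i [c [ci lI]]] := point_lines_in_ideal H1.
exists i, c; split=> //.
have sub p : p \in point_ideal i c -> p \in I.
  by case/point_ideal_lines=> q ->; apply: Isum => j; exact: IM.
have form n (p : R) : p \is n.-homog -> p - p.@[c] *: 'X_i ^+ n \in point_ideal i c.
  move=> hp; rewrite (@point_ideal_form _ i c n).
    by rewrite mevalB mevalZ rmorphXn /= mevalXU ci expr1n mulr1 subrr.
  rewrite rpredB // rpredZ //; have := @dhomogMn 3 K mdeg 1 'X_i n.
  by rewrite mul1n; apply; rewrite dhomogX /= mdeg1.
have homog_case n (p : R) : p \is n.-homog -> p \in I -> p \in point_ideal i c.
  move=> hp pI; rewrite (point_ideal_form i c hp); apply/negPn/negP => pc.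
  have Xn : 'X_i ^+ n \in I.
    have -> : 'X_i ^+ n = (p.@[c])^-1 *: (p - (p - p.@[c] *: 'X_i ^+ n)) :> R.
      by rewrite subKr scalerA mulVf // scale1r.
    by apply: IZ; apply: IB => //; apply: sub; exact: form.
  have [u [hu uI _]] := hilbert_function1 (H1 _ (leq_addl n N)); case/negP: uI.
  rewrite -[u](subrK (u.@[c] *: 'X_i ^+ (n + N))); apply: ID; first exact: sub (form _ _ hu).
  by apply: IZ; rewrite addnC exprD; exact: IM.
move=> p; apply/idP/idP => [pI|]; last exact: sub.
rewrite (@pihomog_partitionE _ _ mdeg _ p (leqnn _)).
have [[P0 _ PD] _] := subst_ker_prime (point_subst i c).
apply: (big_ind (fun q : R => q \in point_ideal i c)) => // [q r qI rI|n _].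
  by rewrite -[q]mul1r; exact: PD.
by apply: (homog_case n); [exact: pihomogP | exact: I_homog].
Qed.

End DegreeOneIdeals.

Lemma homog_mcoeff0 (k : fieldType) n (p : {mpoly k[3]}) :
  (0 < n)%N -> p \is n.-homog -> p@_0%MM = 0.
Proof.
move=> n0 hp; apply: (dhomog_nemf_coeff hp) => /=.
by rewrite mdeg0 eq_sym -lt0n.
Qed.

Section GradedMatrices.
Variable k : fieldType.
Local Notation R := {mpoly k[3]}.
Variables (d e a : nat).

Lemma graded_map_row3 (g p q : R) : (e <= a)%N -> g \is (a + 1 - e).-homog ->
  p \is 1.-homog -> q \is 1.-homog ->
  graded_map [tuple (d + a + 1)%N] [tuple (d + e)%N; (d + a)%N; (d + a)%N] (row3 g p q).
Proof.
move=> le_ea hg hp hq i; rewrite ord1.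
have n1 : (d + a + 1 - (d + e) = a + 1 - e)%N by rewrite -addnA subnDl.
have n2 : (d + a + 1 - (d + a) = 1)%N by rewrite -addnA subnDl addKn.
apply: ord3_ind; rewrite row3E !(tnth_nth 0%N) /=; split=> [_|]; rewrite ?n1 ?n2 //.
- by rewrite -addnA ltn_add2l ltnNge (leq_trans le_ea) ?leq_addr.
- by rewrite addn1 ltnNge leqnSn.
- by rewrite addn1 ltnNge leqnSn.
Qed.

Lemma graded_map_rows3 (u v w : 'rV[R]_3) : vhomog e u -> vhomog a v -> vhomog a w ->
  graded_map [tuple (d + e)%N; (d + a)%N; (d + a)%N] [tuple d; d; d] (rows3 u v w).
Proof.
move=> hu hv hw i j; have -> : tnth [tuple d; d; d] j = d by move: j; apply: ord3_ind.
move: i; apply: ord3_ind; rewrite rows3E !(tnth_nth 0%N) /= addKn;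
  by split=> [_|]; [exact: hu || exact: hv || exact: hw | rewrite ltnNge leq_addr].
Qed.

Lemma graded_map_col3 (F : 'I_3 -> R) : (forall i, F i \is d.-homog) ->
  graded_map [tuple d; d; d] [tuple 0%N] (\col_(i < 3) F i).
Proof.
move=> hF i j; have -> : tnth [tuple d; d; d] i = d by move: i; apply: ord3_ind.
by rewrite ord1 mxE (tnth_nth 0%N) /= subn0.
Qed.

Lemma minimal_row3 (g p q : R) : (e <= a)%N -> g \is (a + 1 - e).-homog ->
  p \is 1.-homog -> q \is 1.-homog -> minimal_map (row3 g p q).
Proof.
move=> le_ea hg hp hq i; rewrite ord1; apply: ord3_ind; rewrite row3E.
- by apply: (homog_mcoeff0 _ hg); rewrite subn_gt0 addn1 ltnS.
- exact: (homog_mcoeff0 _ hp).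
- exact: (homog_mcoeff0 _ hq).
Qed.

Lemma minimal_rows3 (u v w : 'rV[R]_3) : vhomog e u -> vhomog a v -> vhomog a w ->
  (0 < e)%N -> (0 < a)%N -> minimal_map (rows3 u v w).
Proof.
move=> hu hv hw e0 a0 i s; move: i; apply: ord3_ind; rewrite rows3E.
- exact: (homog_mcoeff0 e0 (hu s)).
- exact: (homog_mcoeff0 a0 (hv s)).
- exact: (homog_mcoeff0 a0 (hw s)).
Qed.

End GradedMatrices.

Section DegreeOneToNearlyFree.
Variables (k : closedFieldType) (d : nat) (f : {mpoly k[3]}).
Local Notation R := {mpoly k[3]}.
Local Notation S := (Syz f).
Hypothesis d_gt0 : (0 < d)%N.
Hypothesis hhom : f \is d.+1.-homog.
Hypothesis hf0 : f != 0.
Hypothesis hchar : d.+1%:R != 0 :> k.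
Hypothesis hred : reduced_form f.

Lemma minimal_generator_neq0 (eps : 'rV[R]_3) : minimal_generator S eps -> eps != 0.
Proof.
move=> [_ ming]; apply/eqP => E; apply: ming; exists (fun=> 0).
split=> [i|]; first exact: Syz0.
by rewrite E big1 // => i _; rewrite scaler0.
Qed.

(* The two forms l1, l2 generating the ideal of a point are the images of     *)
(* syzygies E2, E3, whose only relation with eps comes from the Koszul        *)
(* relation of l1 and l2.                                                     *)
Lemma point_ideal_nearly_free (eps E2 E3 : 'rV[R]_3) (e a2 : nat) (phi : 'rV[R]_3 -> R)
    (i j1 j2 : 'I_3) (c : 'I_3 -> k) (g : R) :
  (1 <= e <= a2)%N -> (e + a2 = d.+1)%N ->
  vhomog e eps -> vhomog a2 E2 -> vhomog a2 E3 -> g \is (a2 + 1 - e).-homog ->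
  eps \in S -> E2 \in S -> E3 \in S -> eps != 0 ->
  j1 != i -> j2 != i -> j1 != j2 -> c i = 1 ->
  (forall a u v, u \in S -> v \in S -> phi (a *: u + v) = a * phi u + phi v) ->
  (forall v, v \in S -> (phi v = 0 <-> exists a, v = a *: eps)) ->
  (forall v, v \in S -> phi v \in point_ideal i c) ->
  phi E2 = point_line i c j1 -> phi E3 = point_line i c j2 ->
  point_line i c j2 *: E2 - point_line i c j1 *: E3 = g *: eps ->
  nearly_free d f.
Proof.
move=> ea2 ead heps hE2 hE3 hg epsS E2S E3S eps0 j1i j2i j12 ci phiD phiK phiI pE2 pE3 rel.
set l1 := point_line i c j1 in pE2 rel; set l2 := point_line i c j2 in pE3 rel.
have hl j : point_line i c j \is 1.-homog by rewrite point_lineE; exact: linear_form_homog.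
have c1 : line_coef i c j1 j1 != 0 by rewrite line_coef_diag // oner_eq0.
have l10 : l1 != 0.
  by apply: contraNneq c1; rewrite /l1 point_lineE => /linear_form_eq0/(_ j1) ->.
have phiZ a u : u \in S -> phi (a *: u) = a * phi u by exact: cokernel_mapZ.
have phiDD u v : u \in S -> v \in S -> phi (u + v) = phi u + phi v by exact: cokernel_mapD.
have SD u v : u \in S -> v \in S -> u + v \in S.
  by move=> uS vS; rewrite -[u]scale1r; exact: SyzD.
exists e, a2; split=> //.
exists (row3 g (- l2) l1), (rows3 eps E2 E3), (\col_(r < 3) f^`M(r)).
split; split.
- by apply: graded_map_row3; rewrite ?rpredN //; [case/andP: ea2 | exact: hl | exact: hl].
- exact: graded_map_rows3.
- by apply: graded_map_col3 => j; exact: dhomog_mderiv.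
- by apply: (minimal_row3 (proj2 (andP ea2)) hg); rewrite ?rpredN; exact: hl.
- by case/andP: ea2 => e_gt0 le; apply: (minimal_rows3 heps hE2 hE3) => //; exact: leq_trans le.
- by move=> r s; rewrite mxE; exact: (homog_mcoeff0 d_gt0 (dhomog_mderiv hhom r)).
- move=> b /rowP/(_ o2); rewrite mxE big_ord_recl big_ord0 addr0 row3E mxE => /eqP.
  rewrite mulf_eq0 (negbTE l10) orbF => /eqP b0; apply/rowP => s; rewrite ord1 mxE.
  by rewrite -b0; congr (b _ _); apply: val_inj.
- move=> v; rewrite mulmx_rows3; split=> [vE|[u ->]]; last first.
    set u0 := u 0 0; have uE s : (u *m row3 g (- l2) l1) 0 s = u0 * row3 g (- l2) l1 0 s.
      by rewrite mxE big_ord_recl big_ord0 addr0; congr (u _ _ * _ _ _); apply: val_inj.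
    rewrite !uE !row3E.
    transitivity (u0 *: (g *: eps - (l2 *: E2 - l1 *: E3))); last by rewrite rel subrr scaler0.
    by apply/rowP => s; rewrite !mxE; ring.
  have : phi (v 0 o0 *: eps + v 0 o1 *: E2 + v 0 o2 *: E3) = 0.
    by rewrite vE; exact: (cokernel_map0 phiD).
  rewrite !phiDD ?SD ?SyzZ // !phiZ // pE2 pE3.
  have -> : phi eps = 0 by apply/(phiK _ epsS); exists 1; rewrite scale1r.
  rewrite mulr0 add0r addrC => /eqP; rewrite addr_eq0 -mulNr => /eqP.
  have nprop : linear_form (line_coef i c j2) <>
      (line_coef i c j2 j1 / line_coef i c j1 j1) *: linear_form (line_coef i c j1).
    rewrite line_coef_off // mul0r scale0r => /linear_form_eq0/(_ j2)/eqP.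
    by rewrite line_coef_diag // oner_eq0.
  rewrite /l1 /l2 !point_lineE => /(linear_form_syzygy c1 nprop); rewrite -!point_lineE -/l1 -/l2.
  move=> [h [v2 v1]]; exists h%:M.
  have v0 : v 0 o0 = h * g.
    apply: (kernel_scale_inj eps0); apply/eqP; rewrite -subr_eq0; apply/eqP.
    rewrite -[RHS]vE v2 -[v 0 o1]opprK v1 -scalerA -rel.
    by apply/rowP => s; rewrite !mxE; ring.
  apply/rowP; apply: ord3_ind; rewrite mul_scalar_mx [RHS]mxE row3E //.
  by rewrite mulrN -v1 opprK.
- move=> v; have -> : v *m (\col_r f^`M(r)) = (syz_sum f v)%:M.
    by apply/rowP => s; rewrite ord1 !mxE; apply: eq_bigr => r _; rewrite mxE.
  have -> : ((syz_sum f v)%:M = 0 :> 'M_1) <-> v \in S.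
    rewrite SyzE; split=> [/matrixP/(_ 0 0)|/eqP->]; first by rewrite !mxE mulr1n => ->.
    by apply/matrixP => s t; rewrite !mxE mul0rn.
  split=> [vS|[u ->]]; last first.
    by rewrite mulmx_rows3; rewrite !SD ?SyzZ.
  have [q Eq] := point_ideal_lines (phiI _ vS).
  have Ephi : phi v = q j1 * l1 + q j2 * l2.
    rewrite Eq (bigD1 j1) // (bigD1 j2) 1?eq_sym ?j12 //= big1 ?addr0 // => j /andP[jj1 jj2].
    have -> : j = i by exact: (ord3_third j1i j2i j12).
    by rewrite /point_line ci scale1r subrr mulr0.
  have [a Ea] : exists a, v - (q j1 *: E2 + q j2 *: E3) = a *: eps.
    apply/phiK; first by apply: SyzB => //; rewrite SD ?SyzZ.
    by rewrite (cokernel_mapB phiD) ?SD ?SyzZ // phiDD ?SyzZ // !phiZ // pE2 pE3 Ephi subrr.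
  exists (row3 a (q j1) (q j2)); rewrite mulmx_rows3 !row3E -Ea -addrA subrK //.
- move=> p; split=> [[v ->]|[v E]].
    by exists v; apply/rowP => s; rewrite ord1 !mxE; apply: eq_bigr => r _; rewrite mxE.
  exists v; have /matrixP/(_ 0 0) := E; rewrite !mxE mulr1n => ->.
  by apply: eq_bigr => r _; rewrite mxE.
Qed.

(** The two lines through the point lift to homogeneous syzygies of degree a2 = 1 + d - e. With eps
    they feed [point_ideal_nearly_free], once 1 <= e <= a2 is known. *)
Lemma bourbaki_degree1_nearly_free (I : {pred R}) :
  bourbaki_ideal d f I -> quotient_degree I 1 -> nearly_free d f.
Proof.
move=> [e [eps [indeg ming heps [Iideal Ihomog _ iso]]]] deg1.
have eps0 := minimal_generator_neq0 ming; have epsS : eps \in S by case: ming.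
have [B HB] := bourbaki_codim_bounded hhom hf0 hchar hred heps eps0 epsS iso.
have [phi [phiD phiK phiI phih]] := iso.
have [N HN] : exists N, forall n, (N <= n)%N -> hilbert_function I n 1.
  apply: (quotient_degree_bounded (B := B) (N := e + e) deg1) => n nE.
  have [|W [WI dW]] := HB (n + d - (e + e))%N n.
    by rewrite -addnA subnK // (leq_trans nE) // leq_addr.
  exists ('C(n + 2, n) - \dim W)%N; first by rewrite leq_subLR.
  by apply/(hilbert_functionP WI).
have [i [c [ci IE]]] : exists (i : 'I_3) (c : 'I_3 -> k), c i = 1 /\ I =i point_ideal i c.
  apply: (degree1_ideal_point Iideal Ihomog _ HN) => M p.
  exact: (image_saturated_homog epsS eps0 phiD phiK phiI).
pose j1 := lift i (ord0 : 'I_2); pose j2 := lift i (ord_max : 'I_2).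
have [j1i j2i] : j1 != i /\ j2 != i by rewrite /j1 /j2 ![_ == i]eq_sym !neq_lift.
have j12 : j1 != j2 by rewrite (inj_eq lift_inj).
have l_neq0 j : j != i -> point_line i c j != 0.
  move=> ji; rewrite point_lineE; apply/eqP => /linear_form_eq0/(_ j)/eqP.
  by rewrite line_coef_diag // oner_eq0.
have hl j : point_line i c j \is 1.-homog by rewrite point_lineE; exact: linear_form_homog.
have lift_line j : j != i ->
    (e <= 1 + d)%N /\ exists v, [/\ v \in S, vhomog (1 + d - e) v & phi v = point_line i c j].
  move=> ji; have /phiI[v vS Ev] : point_line i c j \in I by rewrite IE point_line_mem.
  have := pihomog_cokernel_iso hhom 1 phiD phih vS; rewrite Ev (pihomog_dE (hl j)).
  case: leqP => [le_e E|_ /eqP]; last by rewrite (negbTE (l_neq0 _ ji)).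
  split=> //; exists (vcomp (1 + d - e) v); split=> //; last exact: vcompP.
  exact: (Syz_vcomp hhom).
have [le_ed [E2 [E2S hE2 pE2]]] := lift_line _ j1i.
have [_ [E3 [E3S hE3 pE3]]] := lift_line _ j2i.
set a2 := (1 + d - e)%N in hE2 hE3.
(* A syzygy of degree below e is zero, whereas E2 has a nonzero image. *)
have le_ea2 : (e <= a2)%N.
  rewrite leqNgt; apply/negP => lt; have [_ low] := indeg.
  have := l_neq0 _ j1i; rewrite -pE2 (low _ _ lt E2S hE2) (cokernel_map0 phiD).
  by rewrite eqxx.
have [g0 rel0] : exists a, point_line i c j2 *: E2 - point_line i c j1 *: E3 = a *: eps.
  apply/phiK; first by apply: SyzB; exact: SyzZ.
  rewrite (cokernel_mapB phiD) ?SyzZ // !(cokernel_mapZ phiD) // pE2 pE3; ring.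
(* If e = 0, then eps has a nonzero constant coordinate r, and multiples of eps can be subtracted to
   clear coordinate r of E2 and E3. The lifted Koszul relation then has no eps term, so F2 is l_1
   times a syzygy whose image is 1, although I is proper. *)
have e_gt0 : (0 < e)%N.
  rewrite lt0n; apply/eqP => e0.
  have [r er] := rV_neq0 eps0.
  set kap := (eps 0 r)@_0%MM.
  have Ekap : eps 0 r = kap%:MP.
    apply/mpolyP => m; rewrite mcoeffC; case: eqVneq => [->|m0]; first by rewrite mulr1.
    have := heps r; rewrite e0 => hr; rewrite mulr0 (dhomog_nemf_coeff hr) //=.
    by rewrite mdeg_eq0.
  have kap0 : kap != 0 by apply: contraNneq er => E; rewrite Ekap E mpolyC0.
  have norm v : v \in S -> exists v', [/\ v' \in S, phi v' = phi v & v' 0 r = 0].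
    move=> vS; have aS : (kap^-1%:MP * v 0 r) *: eps \in S by exact: SyzZ.
    exists (v - (kap^-1%:MP * v 0 r) *: eps); split; first exact: SyzB.
      have -> : phi v = phi v - 0 by rewrite subr0.
      rewrite (cokernel_mapB phiD vS aS); congr (_ - _).
      by apply/(phiK _ aS); exists (kap^-1%:MP * v 0 r).
    by rewrite !mxE Ekap mulrAC -mpolyCM mulVf // mpolyC1 mul1r subrr.
  have [F2 [F2S pF2 F2r]] := norm _ E2S; have [F3 [F3S pF3 F3r]] := norm _ E3S.
  have S2 a : a *: F2 \in S by exact: SyzZ.
  have S3 a : a *: F3 \in S by exact: SyzZ.
  have [g1 rel1] : exists a, point_line i c j2 *: F2 - point_line i c j1 *: F3 = a *: eps.
    apply/phiK; first exact: SyzB.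
    rewrite (cokernel_mapB phiD (S2 _) (S3 _)).
    rewrite (cokernel_mapZ phiD _ F2S) (cokernel_mapZ phiD _ F3S).
    by rewrite pF2 pF3 pE2 pE3 mulrC subrr.
  have g10 : g1 = 0.
    have /rowP/(_ r) := rel1; rewrite !mxE F2r F3r !mulr0 subr0.
    by move/esym/eqP; rewrite mulf_eq0 (negbTE er) orbF => /eqP.
  have [w Ew] : exists w, F2 = point_line i c j1 *: w.
    move: rel1; rewrite g10 scale0r => /eqP; rewrite subr_eq0 => /eqP.
    rewrite !point_lineE => Erel; apply: (row_linear_syzygy (i := j1) _ _ Erel).
      by rewrite line_coef_diag ?oner_eq0.
    rewrite line_coef_off // mul0r scale0r => /linear_form_eq0/(_ j2)/eqP.
    by rewrite line_coef_diag // oner_eq0.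
  have wS : w \in S by apply: (Syz_saturated (l_neq0 _ j1i)); rewrite -Ew; exact: F2S.
  have phiw : phi w = 1.
    apply: (mulfI (l_neq0 _ j1i)); rewrite -(cokernel_mapZ phiD) // -Ew pF2 pE2.
    by rewrite mulr1.
  by have [_ /negP no1 _] := Iideal; case: no1; apply/phiI; exists w.
(* The left side of [rel0] is homogeneous of degree a2 + 1, so only this component of g0
   contributes. *)
pose g := pihomog mdeg (a2 + 1 - e) g0.
have rel : point_line i c j2 *: E2 - point_line i c j1 *: E3 = g *: eps.
  apply/rowP => s; have /rowP/(_ s) := rel0; rewrite !mxE => E.
  have le : (e <= a2 + 1)%N by rewrite (leq_trans le_ea2) ?leq_addr.
  have := pihomogMr (a2 + 1) g0 (heps s); rewrite le -/g => <-; rewrite -E.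
  apply/esym/pihomog_dE; rewrite [(a2 + 1)%N]addnC rpredB // dhomogM //.
apply: (point_ideal_nearly_free _ _ heps hE2 hE3 (pihomogP _ _ g0) epsS E2S E3S eps0
  j1i j2i j12 ci phiD phiK _ pE2 pE3 rel).
- by rewrite e_gt0.
- by rewrite /a2 subnKC.
- by move=> v vS; rewrite -IE; apply/phiI; exists v.
Qed.

End DegreeOneToNearlyFree.

(** * Nearly free implies degree one *)

Section TwoForms.
Variables (K : fieldType) (a b : 'I_3 -> K).
Local Notation R := {mpoly K[3]}.
Hypothesis a_neq0 : exists i, a i != 0.
Hypothesis ab : forall kap, linear_form b <> kap *: linear_form a.

(** The cross product of the coefficient vectors: the common zero of the two forms. *)
Definition cross (j : 'I_3) : K :=
  tnth [tuple a o1 * b o2 - a o2 * b o1; a o2 * b o0 - a o0 * b o2;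
              a o0 * b o1 - a o1 * b o0] j.

Lemma cross0 : cross o0 = a o1 * b o2 - a o2 * b o1. Proof. by []. Qed.
Lemma cross1 : cross o1 = a o2 * b o0 - a o0 * b o2. Proof. by []. Qed.
Lemma cross2 : cross o2 = a o0 * b o1 - a o1 * b o0. Proof. by []. Qed.

Lemma cross_neq0 : exists i, cross i != 0.
Proof.
apply/existsP; rewrite -[X in is_true X]negbK negb_exists; apply/negP => /forallP z.
have {}z j : cross j = 0 by apply/eqP/negPn; exact: z.
have prop i j : a i * b j = a j * b i.
  have := z o0; have := z o1; have := z o2; rewrite cross0 cross1 cross2.
  move=> /eqP; rewrite subr_eq0 => /eqP e2 /eqP; rewrite subr_eq0 => /eqP e1 /eqP.
  rewrite subr_eq0 => /eqP e0.
  by move: i j; apply: ord3_ind; apply: ord3_ind => //; rewrite ?e0 ?e1 ?e2.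
have [i ai] := a_neq0; apply: (ab (kap := b i / a i)).
rewrite /linear_form scaler_sumr; apply: eq_bigr => j _.
by rewrite scalerA; congr (_ *: _); apply: (mulfI ai); rewrite prop; field.
Qed.

Lemma cross_orthogonal : \sum_j a j * cross j = 0 /\ \sum_j b j * cross j = 0.
Proof. by split; rewrite big_ord3 cross0 cross1 cross2; ring. Qed.

Lemma two_forms_point : exists (i : 'I_3) (c : 'I_3 -> K), c i = 1 /\
  forall p, p \in point_ideal i c <->
    exists u v : R, p = u * linear_form a + v * linear_form b.
Proof.
have [i Pi] := cross_neq0; exists i, (fun j => cross j / cross i).
set c := fun j => _; have ci : c i = 1 by rewrite /c divff.
split=> // p.
have mem_form (s : 'I_3 -> K) : \sum_j s j * cross j = 0 -> linear_form s \in point_ideal i c.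
  move=> E; rewrite (point_ideal_form i c (linear_form_homog s)) /linear_form raddf_sum /=.
  under eq_bigr do rewrite mevalZ mevalXU /c mulrA.
  by rewrite -mulr_suml E mul0r.
have [ca cb] := cross_orthogonal.
split=> [/point_ideal_lines[q ->]|[u [v ->]]]; last first.
  have [[P0 _ PD] _] := subst_ker_prime (point_subst i c).
  apply: (PD); first exact: mem_form.
  by rewrite -[_ * _]addr0; apply: (PD) => //; exact: mem_form.
suff line j : exists s t : K, point_line i c j = s%:MP * linear_form a + t%:MP * linear_form b.
  have [s sP] := fun_choice line; have [t tP] := fun_choice sP.
  exists (\sum_j q j * (s j)%:MP), (\sum_j q j * (t j)%:MP).
  rewrite !mulr_suml -big_split /=; apply: eq_bigr => j _.
  by rewrite tP; ring.
have [s [t E]] : exists s t : K, (cross i)%:MP * 'X_j - (cross j)%:MP * 'X_i =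
    s%:MP * linear_form a + t%:MP * linear_form b.
  have aE s : linear_form s = (s o0)%:MP * 'X_o0 + (s o1)%:MP * 'X_o1 + (s o2)%:MP * 'X_o2 :> R.
    by rewrite /linear_form big_ord3 -!mul_mpolyC.
  clear Pi c ci mem_form ca cb; rewrite !aE; move: i j.
  have sol i j (s t : K) : 
    (cross i)%:MP * 'X_j - (cross j)%:MP * 'X_i =
    s%:MP * linear_form a + t%:MP * linear_form b ->
    exists s t : K, (cross i)%:MP * 'X_j - (cross j)%:MP * 'X_i = s%:MP *
     ((a o0)%:MP * 'X_o0 + (a o1)%:MP * 'X_o1 + (a o2)%:MP * 'X_o2) +
      t%:MP * ((b o0)%:MP * 'X_o0 + (b o1)%:MP * 'X_o1 + (b o2)%:MP * 'X_o2).
    by rewrite !aE; exists s, t.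
  (* The coefficients s, t are read off from (a x b) x X = (a.X) b - (b.X) a. *)
  apply: ord3_ind; apply: ord3_ind.
  - by apply: (sol _ _ 0 0); ring.
  - by apply: (sol _ _ (b o2) (- a o2)); rewrite !aE cross0 cross1; ring.
  - by apply: (sol _ _ (- b o1) (a o1)); rewrite !aE cross0 cross2; ring.
  - by apply: (sol _ _ (- b o2) (a o2)); rewrite !aE cross0 cross1; ring.
  - by apply: (sol _ _ 0 0); ring.
  - by apply: (sol _ _ (b o0) (- a o0)); rewrite !aE cross1 cross2; ring.
  - by apply: (sol _ _ (b o1) (- a o1)); rewrite !aE cross0 cross2; ring.
  - by apply: (sol _ _ (- b o0) (a o0)); rewrite !aE cross1 cross2; ring.
  - by apply: (sol _ _ 0 0); ring.
exists (s / cross i), (t / cross i).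
have Pi0 : (cross i)%:MP != 0 :> R by rewrite mpolyC_eq0.
have cancel (w : K) : (cross i)%:MP * (w / cross i)%:MP = w%:MP :> R.
  by rewrite -mpolyCM mulrC divfK.
apply: (mulfI Pi0); rewrite [in RHS]mulrDr !mulrA !cancel -E.
by rewrite /point_line mulrBr -mul_mpolyC mulrA cancel.
Qed.

End TwoForms.

(** * Syzygy modules with three generators and one minimal relation *)

Section ThreeSyzygies.
Variables (k : closedFieldType) (d : nat) (f : {mpoly k[3]}).
Local Notation R := {mpoly k[3]}.
Local Notation S := (Syz f).
Hypothesis hhom : f \is d.+1.-homog.
Variables (E : 'M[R]_3) (r : 'rV[R]_3) (a1 a2 : nat).
Hypothesis ES : forall v, v \in S <-> exists u, v = u *m E.
Hypothesis Er : forall u, u *m E = 0 <-> exists w, u = w *: r.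
Hypothesis rmin : forall j, (r 0 j)@_0%MM = 0.
Hypothesis r_neq0 : r != 0.
Hypothesis hr1 : r 0 o1 \is 1.-homog.
Hypothesis hr2 : r 0 o2 \is 1.-homog.
Hypothesis hE0 : vhomog a1 (row o0 E).
Hypothesis hE1 : vhomog a2 (row o1 E).
Hypothesis hE2 : vhomog a2 (row o2 E).
Hypothesis a12 : (1 <= a1 <= a2)%N.

Lemma mulmxE3 (u : 'rV[R]_3) :
  u *m E = u 0 o0 *: row o0 E + u 0 o1 *: row o1 E + u 0 o2 *: row o2 E.
Proof. by rewrite mulmx_sum_row big_ord3. Qed.

Lemma relation_min (u : 'rV[R]_3) j : u *m E = 0 -> (u 0 j)@_0%MM = 0.
Proof.
by move=> /Er[w ->]; rewrite mxE rmorphM /= rmin mulr0.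
Qed.

Lemma row_Syz j : row j E \in S.
Proof. by apply/ES; exists (delta_mx 0 j); rewrite -rowE. Qed.

Lemma row_neq0 j : row j E != 0.
Proof.
apply/eqP; rewrite rowE => /(relation_min j)/eqP.
by rewrite mxE !eqxx mcoeff1 eqxx oner_eq0.
Qed.

Lemma generator_not_in_maximal j (u : 'rV[R]_3) :
  (u 0 j)@_0%MM = 0 -> row j E <> u *m E.
Proof.
move=> u0; rewrite rowE => /eqP; rewrite -subr_eq0 -mulmxBl => /eqP/(relation_min j)/eqP.
by rewrite !mxE !eqxx mcoeffB mcoeff1 u0 subr0 eqxx oner_eq0.
Qed.

(* If r_q = kap r_p then g eps = - r_p (E_p + kap E_q), so the linear form r_p *)
(* divides g or eps; both contradict the minimality of the presentation.      *)
Lemma relation_not_proportional (p q : 'I_3) kap : p != o0 -> q != o0 -> p != q ->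
  r 0 p \is 1.-homog -> r 0 q <> kap *: r 0 p.
Proof.
move=> p0 q0 pq hp Eq; set l := r 0 p in hp Eq.
have rE : r *m E = 0 by apply/Er; exists 1; rewrite scale1r.
have rowE3 (u : 'rV[R]_3) : u *m E = u 0 o0 *: row o0 E + u 0 p *: row p E + u 0 q *: row q E.
  rewrite mulmx_sum_row (bigD1 o0) //= (bigD1 p) //= (bigD1 q) /=; last first.
    by rewrite q0 eq_sym pq.
  rewrite big1 ?addr0 ?addrA // => j /andP[/andP[j0 jp] jq].
  by case/eqP: j0; exact: (ord3_third p0 q0 pq).
pose eta := row p E + kap%:MP *: row q E.
have rel : r 0 o0 *: row o0 E = - l *: eta.
  move: rE; rewrite rowE3 Eq -/l -mul_mpolyC => /eqP; rewrite -addrA addr_eq0 => /eqP ->.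
  by apply/rowP => s; rewrite !mxE; ring.
have notdvd : ~ exists h, r 0 o0 = h * l.
  move=> [h Eh].
  case: (eqVneq l 0) => [l0|l0].
    case/eqP: r_neq0; apply/rowP => j; rewrite [RHS]mxE.
    case: (eqVneq j o0) => [->|j0]; first by rewrite Eh l0 mulr0.
    case: (eqVneq j p) => [->|jp] //; case: (eqVneq j q) => [->|jq].
      by rewrite Eq l0 scaler0.
    by case/eqP: j0; exact: (ord3_third p0 q0 pq).
  pose u : 'rV[R]_3 := \row_j (if j == o0 then h else if j == p then 1 else kap%:MP).
  have uE : u *m E = 0.
    apply/rowP => s; rewrite [RHS]mxE; apply: (mulfI l0); rewrite mulr0.
    move/rowP/(_ s): rel; rewrite rowE3 !mxE eqxx (negbTE p0) (negbTE q0) eqxx.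
    rewrite [q == p]eq_sym (negbTE pq) Eh => e.
    transitivity (h * l * E o0 s + l * (E p s + kap%:MP * E q s)); first by ring.
    by rewrite e; ring.
  have := relation_min p uE; rewrite mxE (negbTE p0) eqxx mcoeff1 eqxx => /eqP.
  by rewrite oner_eq0.
case: (eqVneq l 0) => [l0|l0].
  have /eqP := rel; rewrite l0 oppr0 scale0r => /eqP rowz.
  have : r 0 o0 != 0.
    by apply/eqP => z; apply: notdvd; exists 0; rewrite mul0r.
  have [s es] := rV_neq0 (row_neq0 o0).
  move/rowP/(_ s)/eqP: rowz; rewrite !mxE mulf_eq0 => /orP[-> //|].
  by move: es; rewrite mxE => /negbTE->.
have El := linear_formP hp; set a := (fun i => _) in El.
have [i ai] : exists i, a i != 0.
  apply/existsP; apply: contraNT l0; rewrite negb_exists => /forallP z.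
  rewrite El /linear_form big1 // => i _; have /negPn/eqP -> := z i; exact: scale0r.
have div s : exists h, row o0 E 0 s = h * l.
  have /rowP/(_ s) := rel; rewrite !mxE => e.
  have := @linear_form_prime _ _ a i (r 0 o0) (E o0 s) (- eta 0 s) ai.
  rewrite -El !mxE => /(_ _)[|//|//]; first by rewrite e; ring.
have [h hP] := fun_choice div; pose w : 'rV[R]_3 := \row_s h s.
have Ew : row o0 E = l *: w.
  by apply/rowP => s; rewrite [RHS]mxE [w 0 s]mxE hP mulrC.
have /ES[u Eu] : w \in S by apply: (Syz_saturated l0); rewrite -Ew; exact: row_Syz.
apply: (@generator_not_in_maximal o0 (l *: u)); last by rewrite -scalemxAl -Eu.
by rewrite mxE rmorphM /= rmin mul0r.
Qed.

(** Passing to a basis and back changes the identity only by multiples of the relation r. As r has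
    no constant terms, this contradicts r being nonzero, in the manner of Nakayama's lemma. *)
Lemma not_free : ~ free_submodule S.
Proof.
move=> [n [B [BS Bfree]]].
have row_comb j : exists c : 'rV[R]_n, row j E = c *m B by apply/BS; exact: row_Syz.
have [C EC] : exists C : 'M[R]_(3, n), E = C *m B.
  have [c cP] := fun_choice row_comb; exists (\matrix_j c j).
  by apply/row_matrixP => j; rewrite row_mul rowK.
have rowB j : exists u : 'rV[R]_3, row j B = u *m E.
  by apply/ES/BS; exists (delta_mx 0 j); rewrite -rowE.
have [D ED] : exists D : 'M[R]_(n, 3), B = D *m E.
  have [u uP] := fun_choice rowB; exists (\matrix_j u j).
  by apply/row_matrixP => j; rewrite row_mul rowK.
have rC : r *m C = 0.
  by apply: Bfree; rewrite -mulmxA -EC; apply/Er; exists 1; rewrite scale1r.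
have [j rj] := rV_neq0 r_neq0.
(* Each row of C D - 1 is a multiple w_j r of the relation, so r C D = 0 gives *)
(* (1 + sum_j r_j w_j) r = 0.                                                 *)
have rowCD l : exists w, row l (C *m D - 1%:M) = w *: r.
  apply/Er; rewrite -row_mul mulmxBl mul1mx -mulmxA -ED -EC subrr.
  by apply/rowP => s; rewrite !mxE.
have [w Ew] := fun_choice rowCD.
have : r *m (C *m D - 1%:M) = (\sum_l r 0 l * w l) *: r.
  rewrite mulmx_sum_row scaler_suml; apply: eq_bigr => l _.
  by rewrite Ew scalerA.
rewrite mulmxBr mulmxA rC mul0mx sub0r mulmx1 => /rowP/(_ j)/eqP.
rewrite !mxE eq_sym -subr_eq0 opprK -{2}[r 0 j]mul1r -mulrDl mulf_eq0 (negbTE rj) orbF.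
move=> /eqP/(congr1 (mcoeff 0%MM)); rewrite mcoeffD mcoeff1 mcoeff0 eqxx raddf_sum /= big1.
  by rewrite add0r => /eqP; rewrite oner_eq0.
by move=> l _; rewrite rmorphM /= rmin mul0r.
Qed.

Lemma Syz_homog_coef n v : v \in S -> vhomog n v -> exists u : 'rV[R]_3,
  [/\ v = u *m E,
      (n < a1)%N -> u 0 o0 = 0,
      (n < a2)%N -> u 0 o1 = 0 /\ u 0 o2 = 0
    & (a2 <= n)%N -> u 0 o1 \is (n - a2).-homog /\ u 0 o2 \is (n - a2).-homog].
Proof.
move=> /ES[u ->] hv.
pose part a p := if (a <= n)%N then pihomog mdeg (n - a) p else 0 : R.
exists (row3 (part a1 (u 0 o0)) (part a2 (u 0 o1)) (part a2 (u 0 o2))).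
rewrite !row3E; split.
- rewrite [RHS]mulmxE3 !row3E; apply/rowP => s.
  have <- : pihomog mdeg n ((u *m E) 0 s) = (u *m E) 0 s by apply: pihomog_dE; exact: hv.
  rewrite {1}mulmxE3 ![in LHS]mxE ![in RHS]mxE !pihomogD.
  have h0 := hE0 s; have h1 := hE1 s; have h2 := hE2 s; rewrite !mxE in h0 h1 h2.
  rewrite (pihomogMr _ _ h0) (pihomogMr _ _ h1) (pihomogMr _ _ h2) /part.
  by case: ifP; case: ifP; rewrite ?mul0r.
- by move=> lt; rewrite /part leqNgt lt.
- by move=> lt; rewrite /part leqNgt lt.
- by move=> le; rewrite /part le; split; exact: pihomogP.
Qed.

Lemma indeg_Syz : is_indeg S a1.
Proof.
have [a1_gt0 le_a] := andP a12; split.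
  by exists (row o0 E); split=> //; [exact: row_Syz | exact: row_neq0].
move=> n v lt vS hv; have [u [-> u0 u12 _]] := Syz_homog_coef vS hv.
have [u1 u2] := u12 (leq_trans lt le_a).
by rewrite mulmxE3 u0 // u1 u2 !scale0r !addr0.
Qed.

Lemma minimal_row j : minimal_generator S (row j E).
Proof.
split; first exact: row_Syz.
move=> [w [wS Ew]].
have coef i : exists u : 'rV[R]_3, w i = u *m E by apply/ES.
have [u uE] := fun_choice coef.
apply: (@generator_not_in_maximal j (\sum_i 'X_i *: u i)).
  rewrite summxE raddf_sum /= big1 // => i _; rewrite mxE rmorphM /= mcoeffX.
  by rewrite mnm1_eq0 mul0r.
by rewrite Ew mulmx_suml; apply: eq_bigr => i _; rewrite uE scalemxAl.
Qed.

Let l1 := r 0 o1.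
Let l2 := r 0 o2.

Lemma relation_point : exists (i : 'I_3) (c : 'I_3 -> k), c i = 1 /\
  forall p, p \in point_ideal i c <-> exists u v : R, p = u * l1 + v * l2.
Proof.
have E1 := linear_formP hr1; have E2 := linear_formP hr2.
rewrite /l1 /l2 E1 E2; apply: two_forms_point.
  have n1 : r 0 o1 <> 0 *: r 0 o2 by apply: relation_not_proportional.
  apply/existsP; rewrite -[X in is_true X]negbK negb_exists; apply/negP => /forallP z.
  apply: n1; rewrite scale0r E1 /linear_form big1 // => i _.
  by have /negPn/eqP -> := z i; rewrite scale0r.
move=> kap; rewrite -E1 -E2; exact: relation_not_proportional.
Qed.

Lemma relation_syzygy (p q : R) : p * l2 = q * l1 -> exists h, p = h * l1 /\ q = h * l2.
Proof.
have E1 := linear_formP hr1; have E2 := linear_formP hr2.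
have [i ai] : exists i, (r 0 o1)@_U_(i) != 0.
  have n1 : r 0 o1 <> 0 *: r 0 o2 by apply: relation_not_proportional.
  apply/existsP; rewrite -[X in is_true X]negbK negb_exists; apply/negP => /forallP z.
  apply: n1; rewrite scale0r E1 /linear_form big1 // => i _.
  by have /negPn/eqP -> := z i; rewrite scale0r.
rewrite /l1 /l2 E1 E2; apply: (linear_form_syzygy ai).
by rewrite -E1 -E2; exact: relation_not_proportional.
Qed.

(** The coefficients u of v are unique up to multiples of r, on which u_1 l2 - u_2 l1 vanishes, so
    the choice is immaterial. The value 0 outside the syzygies is a default. *)
Definition relation_map (v : 'rV[R]_3) : R :=
  match excluded_middle_informative (exists u, v = u *m E) with
  | left ex => let u := proj1_sig (constructive_indefinite_description _ ex) in
               u 0 o1 * l2 - u 0 o2 * l1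
  | right _ => 0
  end.

Lemma relation_mapE (u : 'rV[R]_3) : relation_map (u *m E) = u 0 o1 * l2 - u 0 o2 * l1.
Proof.
rewrite /relation_map; case: excluded_middle_informative => [ex|[]]; last by exists u.
case: constructive_indefinite_description => u' /= /eqP.
rewrite -subr_eq0 -mulmxBl => /eqP/Er[w /rowP Ew].
have := Ew o1; have := Ew o2; rewrite !mxE -/l1 -/l2 => /eqP + /eqP.
rewrite !subr_eq => /eqP -> /eqP ->; ring.
Qed.

(** If u_1 l2 = u_2 l1, then (u_1, u_2) = h (l1, l2), and subtracting h r from u leaves a multiple
    of the first generator. In degree n the coefficients u_1, u_2 have degree n - a2 and the linear
    forms add 1, which gives the shift a1 + a2 - 1. *)
Lemma relation_cokernel (i : 'I_3) (c : 'I_3 -> k) :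
  (forall p, p \in point_ideal i c <-> exists u v : R, p = u * l1 + v * l2) ->
  cokernel_iso S (row o0 E) a1 (a1 + a2 - 1) (point_ideal i c).
Proof.
move=> ptE; exists relation_map; split.
- move=> a v w /ES[u ->] /ES[u' ->]; rewrite scalemxAl -mulmxDl !relation_mapE !mxE; ring.
- move=> v /ES[u ->]; rewrite relation_mapE; split=> [/eqP|[a Ea]].
    rewrite subr_eq0 => /eqP/relation_syzygy[h [e1 e2]].
    exists (u 0 o0 - h * r 0 o0).
    have hr : (h *: r) *m E = 0 by apply/Er; exists h.
    rewrite -[LHS]subr0 -hr -mulmxBl mulmxE3 !mxE e1 e2 -/l1 -/l2 !subrr !scale0r !addr0 //.
  have : (u - a *: delta_mx 0 o0) *m E = 0 by rewrite mulmxBl Ea -scalemxAl -rowE subrr.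
  case/Er=> w /rowP Ew; have := Ew o1; have := Ew o2; rewrite !mxE /= !mulr0 !subr0.
  by move=> -> ->; rewrite /l1 /l2; ring.
- move=> p; rewrite ptE; split=> [[u [v ->]]|[v /ES[u ->] <-]].
    exists (row3 0 v (- u) *m E); first by apply/ES; exists (row3 0 v (- u)).
    by rewrite relation_mapE !row3E; ring.
  by rewrite relation_mapE; exists (- u 0 o2), (u 0 o1); ring.
- have [a1_gt0 le_a] := andP a12.
  move=> n v vS hv; have [u [-> _ low high]] := Syz_homog_coef vS hv; rewrite relation_mapE.
  case: (ltnP n a2) => [lt|le].
    have [-> ->] := low lt; rewrite !mul0r subrr; split=> // _; exact: rpred0.
  have [h1 h2] := high le.
  have Edeg : (n + a1 - (a1 + a2 - 1))%N = (n - a2 + 1)%N by clear -le a1_gt0 le_a; lia.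
  split=> [_|lt]; last by clear -lt le a1_gt0 le_a; exfalso; lia.
  by rewrite Edeg rpredB // dhomogM.
Qed.

End ThreeSyzygies.

Section NearlyFreeToBourbaki.
Variables (k : closedFieldType) (d : nat) (f : {mpoly k[3]}).
Local Notation R := {mpoly k[3]}.
Local Notation S := (Syz f).
Hypothesis hhom : f \is d.+1.-homog.
Hypothesis hf0 : f != 0.
Hypothesis hchar : d.+1%:R != 0 :> k.
Hypothesis hred : reduced_form f.

Lemma is_indeg_inj (M : {pred 'rV[R]_3}) e e' : is_indeg M e -> is_indeg M e' -> e = e'.
Proof.
move=> [[v [vM hv v0]] low] [[v' [v'M hv' v'0]] low']; case: (ltngtP e e') => // lt.
  by case/eqP: v0; exact: low' lt vM hv.
by case/eqP: v'0; exact: low lt v'M hv'.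
Qed.

(** By [bourbaki_dim] the dimension of a Bourbaki ideal in large degrees depends on f and e only, so
    I' also has Hilbert function 1 there. *)
Lemma bourbaki_degree_unique (I I' : {pred R}) m :
  bourbaki_ideal d f I -> (forall n, hilbert_function I n 1) ->
  bourbaki_ideal d f I' -> quotient_degree I' m -> m = 1%N.
Proof.
move=> [e [eps [indeg ming heps [_ _ _ iso]]]] I1.
move=> [e' [eps' [indeg' ming' heps' [_ _ _ iso']]]] degm.
have Ee := is_indeg_inj indeg' indeg; rewrite {}Ee in heps' iso' indeg'.
have I'1 n : (e + e <= n)%N -> hilbert_function I' n 1.
  move=> le; pose N := (n + d - (e + e))%N.
  have nd : (n + d = N + e + e)%N by rewrite -addnA subnK // (leq_trans le) // leq_addr.
  have [S0 [_ [SE _ _]]] := Syz_dim hhom (N + e).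
  have [W [WE dW]] := bourbaki_dim hhom heps (minimal_generator_neq0 ming) ming.1 iso nd SE.
  have [W' [WE' dW']] :=
    bourbaki_dim hhom heps' (minimal_generator_neq0 ming') ming'.1 iso' nd SE.
  have EW : \dim W = \dim W' by apply/eqP; rewrite -(eqn_add2l 'C(N + 2, N)) dW dW'.
  by apply/(hilbert_functionP WE'); rewrite -EW; apply/(hilbert_functionP WE).
have [|N HN] := quotient_degree_bounded (B := 1) (N := e + e) degm.
  by move=> n /I'1 H; exists 1%N.
apply: (hilbert_function_inj (n := N + (e + e)) (HN _ (leq_addr _ _))).
exact: I'1 (leq_addl _ _).
Qed.

Lemma presentation_Bour1 (E : 'M[R]_3) (r : 'rV[R]_3) (a1 a2 : nat) :
  (forall v, v \in S <-> exists u, v = u *m E) ->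
  (forall u, u *m E = 0 <-> exists w, u = w *: r) ->
  (forall j, (r 0 j)@_0%MM = 0) -> r != 0 ->
  r 0 o1 \is 1.-homog -> r 0 o2 \is 1.-homog ->
  vhomog a1 (row o0 E) -> vhomog a2 (row o1 E) -> vhomog a2 (row o2 E) ->
  (1 <= a1 <= a2)%N -> Bour d f = 1%N.
Proof.
move=> ES Er rmin r0 hr1 hr2 hE0 hE1 hE2 a12.
have [i [c [ci ptE]]] := relation_point ES Er rmin r0 hr1 hr2.
have iso := relation_cokernel ES Er rmin r0 hr1 hr2 hE0 hE1 hE2 a12 ptE.
have E0S := row_Syz ES o0; have E00 := row_neq0 Er rmin o0.
(* The twists of the resolution do not state this equality; it follows from comparing Hilbert
   functions. *)
have dE : (a1 + a2 - 1)%N = d.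
  apply: (bourbaki_shift hhom hf0 hchar hred hE0 E00 E0S iso) => m.
  exact: point_ideal_dim.
rewrite dE in iso.
have bI : bourbaki_ideal d f (point_ideal i c).
  exists a1, (row o0 E); split=> //.
  - exact: indeg_Syz.
  - exact: minimal_row.
  split=> //; [exact: subst_ker_idealr | exact: point_ideal_homogeneous | exact: point_ideal_codim].
have I1 n : hilbert_function (point_ideal i c) n 1.
  have [W [WE dW]] := point_ideal_dim ci n.
  by apply/(hilbert_functionP WE); rewrite -dW addnC addnK.
rewrite /Bour; case: (excluded_middle_informative (free_divisor f)) => [free|nofree].
  by case: (not_free ES Er rmin r0).
case: excluded_middle_informative => [ex|[]]; last first.
  by exists 1%N; exists (point_ideal i c) => //; exact: quotient_degree1.
case: constructive_indefinite_description => m /= [I' bI' degm].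
exact: bourbaki_degree_unique bI I1 bI' degm.
Qed.

Definition gradient : 'cV[R]_3 := \col_i f^`M(i).

Lemma mulmx_gradient (v : 'rV[R]_3) : v *m gradient = (syz_sum f v)%:M.
Proof. by apply/rowP => s; rewrite ord1 !mxE; apply: eq_bigr => j _; rewrite mxE. Qed.

Lemma Syz_gradient (v : 'rV[R]_3) : v \in S <-> v *m gradient = 0.
Proof.
rewrite mulmx_gradient SyzE; split=> [/eqP->|/matrixP/(_ 0 0)].
  by apply/matrixP => s t; rewrite !mxE mul0rn.
by rewrite !mxE mulr1n => ->.
Qed.

(** All entries have the same degree n, so only the constant terms of the coefficients matter. *)
Lemma homog_span (n : nat) (A B : 'cV[R]_3) :
  (forall j, A j 0 \is n.-homog) -> (forall j, B j 0 \is n.-homog) ->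
  (forall j, exists v : 'rV[R]_3, (A j 0)%:M = v *m B) ->
  exists T : 'M[k]_3, A = map_mx (@mpolyC 3 k) T *m B.
Proof.
move=> hA hB AB.
have [V EV] : exists V : 'M[R]_3, A = V *m B.
  have [v vP] := fun_choice AB; exists (\matrix_j v j).
  apply/row_matrixP => j; rewrite row_mul rowK -vP.
  by apply/rowP => s; rewrite ord1 !mxE mulr1n.
exists (map_mx (mcoeff 0%MM) V); apply/colP => j.
have /colP/(_ j) := EV; rewrite !mxE => e.
rewrite -(pihomog_dE (hA j)) e raddf_sum /=; apply: eq_bigr => l _.
rewrite (pihomogMr _ _ (hB l)) leqnn subnn !mxE; congr (_ * _).
apply/mpolyP => m; rewrite mcoeff_pihomog mcoeffC mdeg_eq0.
by case: eqP => [->|_]; rewrite ?mulr1 ?mulr0.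
Qed.

(** The resolution may use any three generators A1 of J_f, so it is first carried over to the
    partial derivatives by an invertible constant matrix T, with E = A2 T as the matrix of
    syzygies. *)
Lemma nearly_free_Bour1 : nearly_free d f -> Bour d f = 1%N.
Proof.
move=> [a1 [a2 [a12 [A3 [A2 [A1 [[g3 g2 g1] [m3 m2 _] [inj3 ex32 ex21 grad]]]]]]]].
have hA1 j : A1 j 0 \is d.-homog.
  have [h _] := g1 j 0; have Ed : tnth [tuple d; d; d] j = d by move: j {h}; apply: ord3_ind.
  by move: h; rewrite Ed (tnth_nth 0%N) /= subn0; apply.
have [T ET] : exists T : 'M[k]_3, A1 = map_mx (@mpolyC 3 k) T *m gradient.
  apply: (homog_span hA1) => [j|j]; first by rewrite mxE; exact: dhomog_mderiv.
  have [v Ev] : gradient_ideal f (A1 j 0).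
    apply/grad; exists (delta_mx 0 j); rewrite -rowE.
    by apply/rowP => s; rewrite ord1 !mxE mulr1n.
  by exists v; rewrite mulmx_gradient Ev.
have [U EU] : exists U : 'M[k]_3, gradient = map_mx (@mpolyC 3 k) U *m A1.
  apply: homog_span hA1 _ => j; first by rewrite mxE; exact: dhomog_mderiv.
  apply/grad; exists (delta_mx 0 j); rewrite mxE /syz_sum (bigD1 j) //= !mxE !eqxx mul1r.
  by rewrite big1 ?addr0 // => l /negbTE lj; rewrite !mxE lj mul0r.
(* The rows of T U - 1 are relations among the entries of A1, so they lie in the image of A2, whose
   entries have no constant term; being constant, they vanish. *)
have TU : T *m U = 1%:M.
  apply/row_matrixP => j; apply/rowP => s.
  have : row j (map_mx (@mpolyC 3 k) (T *m U - 1%:M)) *m A1 = 0.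
    rewrite -row_mul map_mxB map_mxM map_mx1 mulmxBl mul1mx -mulmxA -EU -ET subrr.
    by apply/rowP => t; rewrite !mxE.
  move/ex21 => [u /rowP/(_ s)/(congr1 (mcoeff 0%MM))].
  rewrite [in RHS]mxE raddf_sum /= big1 => [|l _]; last by rewrite rmorphM /= m2 mulr0.
  by rewrite !mxE mcoeffC eqxx mulr1 => /eqP; rewrite subr_eq0 => /eqP.
pose CT := map_mx (@mpolyC 3 k) T; pose CU := map_mx (@mpolyC 3 k) U.
have CTU : CT *m CU = 1%:M by rewrite -map_mxM TU map_mx1.
have CUT : CU *m CT = 1%:M by exact: mulmx1C.
have rE u : (u *m (A2 *m CT) = 0) <-> exists w : R, u = w *: A3.
  split=> [E|[w ->]].
    have /ex32[w ->] : u *m A2 = 0.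
      by rewrite -[LHS]mulmx1 -CTU mulmxA -[u *m _ *m _]mulmxA E mul0mx.
    by exists (w 0 0); rewrite {1}[w]mx11_scalar mul_scalar_mx.
  have A32 : A3 *m A2 = 0 by apply/ex32; exists 1%:M; rewrite mul1mx.
  by rewrite mulmxA -scalemxAl A32 scaler0 mul0mx.
have ES v : v \in S <-> exists u, v = u *m (A2 *m CT).
  rewrite Syz_gradient EU mulmxA; split=> [/ex21[u Eu]|[u ->]].
    by exists u; rewrite mulmxA -Eu -mulmxA CUT mulmx1.
  apply/ex21; exists u; by rewrite -!mulmxA -/CU CTU mulmx1.
have hE j n : (forall s, A2 j s \is n.-homog) -> vhomog n (row j (A2 *m CT)).
  move=> h s; rewrite !mxE rpred_sum // => l _; rewrite mxE mulrC mul_mpolyC.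
  by apply: rpredZ; exact: h.
have degA2 j s : (d <= tnth [tuple (d + a1)%N; (d + a2)%N; (d + a2)%N] j)%N ->
    A2 j s \is (tnth [tuple (d + a1)%N; (d + a2)%N; (d + a2)%N] j - d).-homog.
  have [h _] := g2 j s; have Ed : tnth [tuple d; d; d] s = d by move: s {h}; apply: ord3_ind.
  by move: h; rewrite Ed.
apply: (presentation_Bour1 ES rE (a1 := a1) (a2 := a2)) => //.
- apply/eqP => A30; have := inj3 1%:M; rewrite A30 mulmx0 => /(_ erefl)/matrixP/(_ 0 0)/eqP.
  by rewrite !mxE oner_eq0.
- have [h _] := g3 0 o1; move: h; rewrite !(tnth_nth 0%N) /= -addnA leq_add2l leq_addr.
  by rewrite subnDl addKn; apply.
- have [h _] := g3 0 o2; move: h; rewrite !(tnth_nth 0%N) /= -addnA leq_add2l leq_addr.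
  by rewrite subnDl addKn; apply.
- by apply: hE => s; have := degA2 o0 s; rewrite (tnth_nth 0%N) /= addKn; apply; exact: leq_addr.
- by apply: hE => s; have := degA2 o1 s; rewrite (tnth_nth 0%N) /= addKn; apply; exact: leq_addr.
- by apply: hE => s; have := degA2 o2 s; rewrite (tnth_nth 0%N) /= addKn; apply; exact: leq_addr.
Qed.

End NearlyFreeToBourbaki.

Theorem proposition2p18 (k : closedFieldType) (d : nat) (f : {mpoly k[3]})
    (hd : (2 <= d.+1)%N) (hchar : d.+1%:R != 0 :> k)
    (hf0 : f != 0) (hhom : f \is d.+1.-homog) (hred : reduced_form f) :
  Bour d f = 1%N <-> nearly_free d f.
Proof.
split; last exact: nearly_free_Bour1.
(* Both default values of [Bour] are 0, so the value 1 comes from an actual Bourbaki ideal of degree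
   1. *)
rewrite /Bour; case: (excluded_middle_informative (free_divisor f)) => [//|nofree].
case: excluded_middle_informative => [ex|//].
case: constructive_indefinite_description => m /= [I bI degm] m1.
by rewrite m1 in degm; exact: (bourbaki_degree1_nearly_free _ hhom hf0 hchar hred bI degm).
Qed.
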